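(* Let $\mathbb X$ be a countable ultrahomogeneous strict partial order which is not a countable antichain. Then for every linear order $L$ the following are equivalent: (a) $L$ is isomorphic to a maximal chain in the poset $\langle \mathbb P(\mathbb X)\cup\{\emptyset\},\subset\rangle$; (b) $L$ is an $\mathbb R$-embeddable complete linear order whose least element $0_L$ is non-isolated; (c) $L$ is isomorphic to a compact set $K\subset\mathbb R$ (with the order inherited from $\mathbb R$) such that $0_K=\min K$ is an accumulation point of $K$. If $\mathbb X$ is a countable antichain (the empty relation on a countable set), then for every linear order $L$ the following are equivalent: (a) $L$ is isomorphic to a maximal chain in $\langle \mathbb P(\mathbb X)\cup\{\emptyset\},\subset\rangle$; (b) $L$ is an $\mathbb R$-embeddable Boolean linear order with $0_L$ non-isolated; (c) $L$ is isomorphic to a compact nowhere dense set $K\subset\mathbb R$ such that $\min K$ is an accumulation point of $K$.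
   Context: For a strict partial order $\mathbb X=\langle X,<\rangle$, $\mathbb P(\mathbb X)$ denotes the set of all $A\subset X$ such that the suborder $\langle A,<\cap A^2\rangle$ is isomorphic to $\mathbb X$ (equivalently, the set of images $f[X]$ of self-embeddings $f$ of $\mathbb X$). $\mathbb X$ is ultrahomogeneous if every isomorphism between finite suborders of $\mathbb X$ extends to an automorphism of $\mathbb X$. A linear order is $\mathbb R$-embeddable if it embeds into $\langle\mathbb R,<\rangle$. A linear order is complete if it has a least element $0_L$ and a greatest element and has no gaps (every cut has a maximum in the lower part or a minimum in the upper part). $0_L$ is non-isolated means $0_L$ has no immediate successor in $L$. A linear order is Boolean if it is complete and has dense jumps: for all $x<y$ in $L$ there are $a<b$ with $x\le a<b\le y$ and the open interval $(a,b)_L$ empty.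
   Formalization: ''0_L is non-isolated'' also requires L to have more than one element (the one-element order satisfies (b) literally but neither (a) nor (c)), and ''countable'' means countably infinite (the equivalences fail for finite X). *)

(* Defs.v *)
From mathcomp Require Export all_boot all_order all_algebra.
From mathcomp Require Export all_classical all_reals all_analysis.
Set Implicit Arguments.
Unset Strict Implicit.
Unset Printing Implicit Defensive.
Import Order.TTheory GRing.Theory Num.Theory numFieldNormedType.Exports.
Local Open Scope classical_set_scope.
Local Open Scope order_scope.

(* f restricts to an isomorphism from the suborder A of (T, rT) onto the
   suborder B of (U, rU); the values of f outside A are irrelevant. *)
Definition is_iso (T U : Type) (rT : T -> T -> Prop) (rU : U -> U -> Prop)
    (A : set T) (B : set U) (f : T -> U) : Prop :=
  set_bij A B f /\ forall x y, A x -> A y -> (rT x y <-> rU (f x) (f y)).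

Definition isomorphic (T U : Type) (rT : T -> T -> Prop) (rU : U -> U -> Prop)
    (A : set T) (B : set U) : Prop :=
  exists f : T -> U, is_iso rT rU A B f.

Definition slt (d : Order.disp_t) (T : porderType d) (x y : T) : Prop := x < y.

Definition copies (d : Order.disp_t) (X : porderType d) : set (set X) :=
  [set A | isomorphic (@slt d X) (@slt d X) setT A].
Arguments copies {d} X.

Definition ultrahomogeneous (d : Order.disp_t) (X : porderType d) : Prop :=
  forall (A B : set X) (f : X -> X),
    finite_set A -> finite_set B -> is_iso (@slt d X) (@slt d X) A B f ->
    exists2 g : X -> X, is_iso (@slt d X) (@slt d X) setT setT g &
      forall x, A x -> g x = f x.

Definition antichain (d : Order.disp_t) (X : porderType d) : Prop :=
  forall x y : X, ~ (x < y).

Definition maximal_chain (T : Type) (P C : set (set T)) : Prop :=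
  [/\ C `<=` P, total_on C subset &
      forall D, D `<=` P -> total_on D subset -> C `<=` D -> D = C].

Definition iso_maximal_chain_of_copies (d d' : Order.disp_t) (X : porderType d)
    (L : orderType d') : Prop :=
  exists2 C : set (set X), maximal_chain (copies X `|` [set set0]) C &
    isomorphic (@slt d' L) (fun A B : set X => A `<` B) setT C.

Definition embeddable_in (d d' : Order.disp_t) (R : porderType d)
    (L : orderType d') : Prop :=
  exists f : L -> R, {mono f : x y / x < y}.

Definition is_cut (d : Order.disp_t) (L : orderType d) (A B : set L) : Prop :=
  [/\ A !=set0, B !=set0, A `|` B = setT & forall a b, A a -> B b -> a < b].

Definition complete_order (d : Order.disp_t) (L : orderType d) : Prop :=
  [/\ exists z : L, forall x, z <= x,
      exists u : L, forall x, x <= u &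
      forall A B : set L, is_cut A B ->
        (exists2 a, A a & ubound A a) \/ (exists2 b, B b & lbound B b)].

Definition is_jump (d : Order.disp_t) (L : orderType d) (a b : L) : Prop :=
  a < b /\ ~ exists y, a < y < b.

Definition dense_jumps (d : Order.disp_t) (L : orderType d) : Prop :=
  forall x y : L, x < y -> exists a b : L, [/\ x <= a, is_jump a b & b <= y].

Definition boolean_order (d : Order.disp_t) (L : orderType d) : Prop :=
  complete_order L /\ dense_jumps L.

(* The clause [exists x, z < x] only excludes the one-element order, whose
   least element has no immediate successor but is an isolated point. *)
Definition bottom_nonisolated (d : Order.disp_t) (L : orderType d) : Prop :=
  exists z : L, [/\ forall x, z <= x, exists x, z < x &
                    ~ exists s, is_jump z s].

Definition min_accumulation (R : realType) (K : set R) : Prop :=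
  exists m : R, [/\ K m, lbound K m & limit_point K m].

Definition nowhere_dense (T : topologicalType) (K : set T) : Prop :=
  interior (closure K) = set0.

(* Main.v *)
Require Import Defs.
Import Order.TTheory GRing.Theory Num.Theory numFieldNormedType.Exports.
Local Open Scope classical_set_scope.
Local Open Scope order_scope.

(* A subset A of an ultrahomogeneous X is a copy iff A realizes every one-point
   type over a finite subset of A that X realizes (back-and-forth).  Hence unions
   of chains of copies are copies, which makes maximal chains complete, and
   chains of subsets of a countable set embed in R by binary weights.

   Conversely, let K be compact with minimum b, J the left end points of its
   gaps and D a countable dense subset of its interior.  A labelling
   phi : X -> J u D such that {phi < t} is a copy for every t > b, fibres over J
   admit no intermediate copy, and x < y with phi x in D implies phi x < phi y
   yields the maximal chain {phi < t}, t in K: an element labelled s in D is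
   maximal in {phi <= s}, whereas copies have no maximal element.  Such
   labellings are obtained generically by finite approximations, provided that
   the realizations of a type can avoid lying above finitely many given elements.
   This holds for disjoint unions of chains and for the random poset; when
   incomparability is transitive one labels a transversal of the levels first.
   These three cases exhaust the ultrahomogeneous posets with a comparable pair.

   A complete order embeddable in R is mapped onto a compact set by a generic
   strictly monotone map into [0, 1] such that every rational of ]0, 1[ is a
   value or is separated from the values by the image of a jump. *)

Set Implicit Arguments.
Unset Strict Implicit.
Unset Printing Implicit Defensive.

(** * Copies and finite partial isomorphisms *)

(** Labels in J alone do not suffice: an interval has no gaps, yet every element must enter the
    chain somewhere. At an inner label s the sets {phi < s} and {phi <= s} differ while only the
    first belongs to the chain, so the second must fail to be a copy; a maximal element achieves
    this once X has a comparable pair. An antichain offers no such device, which forces D to be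
    empty, that is, K to have empty interior. A further obstacle is a poset with nontrivial classes
    of incomparability, its levels. The last missing point of a finite level has no second
    realization of its type over the rest, so such a level must enter as a whole. An infinite level
    entering as a whole at a label of J would leave an intermediate copy, with one point of the
    level omitted, so there the labels in J must be used injectively. In the compact representation
    the difficulty is that an arbitrary embedding into the reals may lose limits: its image need not
    be closed. *)

Lemma generic_filter (T : eqType) (good : seq T -> Prop) (I : Type)
    (code : I -> nat) (D : I -> seq T -> Prop) :
  injective code -> good [::] ->
  (forall i p, good p -> exists q : seq T, [/\ good q, {subset p <= q} & D i q]) ->
  exists G : set T,
    (forall l : seq T, (forall u, u \in l -> G u) ->
       exists p : seq T, [/\ good p, {subset l <= p} & forall u, u \in p -> G u]) /\
    (forall i, exists p : seq T, [/\ good p, D i p & forall u, u \in p -> G u]).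
Proof.
move=> inj good0 dense.
have /choice[f fP] (np : nat * seq T) : exists q : seq T, good np.2 ->
    [/\ good q, {subset np.2 <= q} & forall i, code i = np.1 -> D i q].
  case: np => [n p] /=; case: (pselect (exists i, code i = n)) => [[i <-]|no].
    case: (pselect (good p)) => gp; last by exists p.
    have [q [gq pq Dq]] := dense i p gp.
    by exists q => _; split => // j /inj ->.
  by exists p => gp; split => // i ei; case: no; exists i.
pose s := fix s n := if n is n'.+1 then f (n', s n') else [::].
have sgood n : good (s n) by elim: n => //= n /(fP (n, _)) [].
have sle m n : (m <= n)%N -> {subset s m <= s n}.
  elim: n => [|n IH]; first by rewrite leqn0 => /eqP ->.
  rewrite leq_eqVlt => /orP[/eqP -> //|/IH mn] u /mn un /=.
  by have [_ + _] := fP (n, s n) (sgood n); apply.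
exists [set u | exists n, u \in s n]; split => [l|i].
  elim: l => [|u l IH] lG; first by exists [::].
  suff [n nP] : exists n, {subset u :: l <= s n}.
    by exists (s n); split=> // v vn; exists n.
  elim: {IH} (u :: l) lG => [|v k IH] kG; first by exists 0%N.
  have [|n nP] := IH; first by move=> w wk; apply: kG; rewrite inE wk orbT.
  have [m mP] := kG v (mem_head _ _).
  exists (maxn n m) => w; rewrite inE => /orP[/eqP ->|/nP].
    by apply: sle mP; rewrite leq_maxr.
  by apply: sle; rewrite leq_maxl.
exists (s (code i).+1); split=> //; last by move=> u us; exists (code i).+1.
by have [_ _] := fP (code i, s (code i)) (sgood _); apply.
Qed.

Definition piso (d : Order.disp_t) (X : porderType d) (p : seq (X * X)) : bool :=
  all (fun u => all (fun v =>
    ((u.1 == v.1) == (u.2 == v.2)) && ((u.1 < v.1) == (u.2 < v.2))) p) p.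

(** Extension by one point, the form of ultrahomogeneity that back-and-forth consumes. *)
Definition homogeneous (d : Order.disp_t) (X : porderType d) : Prop :=
  forall p : seq (X * X), piso p -> forall x, exists y, piso ((x, y) :: p).

Definition same_type (d : Order.disp_t) (X : porderType d) (F : seq X)
    (x y : X) : bool :=
  all (fun f => ((f < x) == (f < y)) && ((x < f) == (y < f))) F.

(** Since [same_type] records strict comparabilities but not equality, both points are kept outside
    [F]; in an infinite antichain this clause alone says that [A] is infinite. *)
Definition realizes_types (d : Order.disp_t) (X : porderType d) (A : set X) :
    Prop :=
  forall (F : seq X) (x : X), (forall f, f \in F -> A f) -> x \notin F ->
    exists y, [/\ A y, y \notin F & same_type F x y].

Section Homogeneity.
Context (d : Order.disp_t) (X : porderType d).
Implicit Types (p : seq (X * X)) (F : seq X).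

Lemma pisoP p : reflect (forall u v, u \in p -> v \in p ->
  (u.1 == v.1) = (u.2 == v.2) /\ (u.1 < v.1) = (u.2 < v.2)) (piso p).
Proof.
apply: (iffP allP) => [h u v up vp|h u up].
  by have /allP/(_ v vp)/andP[/eqP -> /eqP ->] := h u up.
by apply/allP => v vp; have [-> ->] := h u v up vp; rewrite !eqxx.
Qed.

Lemma same_typeP F x y : reflect (forall f, f \in F ->
  (f < x) = (f < y) /\ (x < f) = (y < f)) (same_type F x y).
Proof.
apply: (iffP allP) => [h f /h /andP[/eqP -> /eqP ->] //|h f /h [-> ->]].
by rewrite !eqxx.
Qed.

Lemma same_type_refl F x : same_type F x x.
Proof. exact/same_typeP. Qed.

Lemma same_type_trans F y x z :
  same_type F x y -> same_type F y z -> same_type F x z.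
Proof.
by move=> /same_typeP h /same_typeP k; apply/same_typeP => f fF;
  have [-> ->] := h f fF; apply: k.
Qed.

Lemma piso_swap p : piso [seq (u.2, u.1) | u <- p] = piso p.
Proof.
apply/pisoP/pisoP => h u v.
  by move=> up vp; have [] := h (u.2, u.1) (v.2, v.1)
    (map_f (fun u => (u.2, u.1)) up) (map_f (fun u => (u.2, u.1)) vp).
by move=> /mapP[u' /h + ->] /mapP[v' + ->] => /[apply] -[-> ->].
Qed.

Lemma piso_cons p x y : piso p ->
  (forall u, u \in p -> [/\ (u.1 == x) = (u.2 == y),
     (u.1 < x) = (u.2 < y) & (x < u.1) = (y < u.2)]) ->
  piso ((x, y) :: p).
Proof.
move=> /pisoP pp h; apply/pisoP => u v.
rewrite !inE => /orP[/eqP -> |up] /orP[/eqP -> |vp] /=.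
- by rewrite !eqxx !ltxx.
- by have [e l g] := h v vp; rewrite eq_sym e eq_sym g.
- by have [e l g] := h u up.
- exact: pp.
Qed.

Lemma piso_consP p x y : piso ((x, y) :: p) -> piso p /\
  (forall u, u \in p -> [/\ (u.1 == x) = (u.2 == y),
     (u.1 < x) = (u.2 < y) & (x < u.1) = (y < u.2)]).
Proof.
move=> /pisoP pp; split.
  by apply/pisoP => u v up vp; apply: pp; rewrite inE ?up ?vp orbT.
move=> u up.
have u' : u \in (x, y) :: p by rewrite inE up orbT.
have h : (x, y) \in (x, y) :: p by rewrite mem_head.
by have [-> ->] := pp u _ u' h; have [_ ->] := pp _ u h u'.
Qed.

Lemma homogeneous_back : homogeneous X -> forall p, piso p ->
  forall y, exists x, piso ((x, y) :: p).
Proof.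
move=> hom p pp y; rewrite -piso_swap in pp.
by have [x xP] := hom _ pp y; exists x; rewrite -piso_swap.
Qed.

Lemma ultrahomogeneous_homogeneous : ultrahomogeneous X -> homogeneous X.
Proof.
move=> uh p /pisoP pp x.
(* Lookup of [z] among the pairs of [p]; outside the domain the default value [z] is harmless, as
   [is_iso] ignores it. *)
pose f z := nth z [seq u.2 | u <- p] (index z [seq u.1 | u <- p]).
have fP u : u \in p -> f u.1 = u.2.
  move=> up; rewrite /f.
  have i1 : (index u.1 [seq u.1 | u <- p] < size p)%N.
    by rewrite -(size_map fst) index_mem map_f.
  rewrite (nth_map u) //; set v := nth u p _.
  have vp : v \in p by rewrite mem_nth.
  have : v.1 = u.1.
    by rewrite -(nth_map u u.1) ?nth_index // map_f.
  by move/eqP; have [-> _] := pp v u vp up => /eqP.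
have [|||g [[_ ginj _] gm] gf] := uh [set` [seq u.1 | u <- p]]
    [set` [seq u.2 | u <- p]] f.
- exact: finite_seq.
- exact: finite_seq.
- split.
    split.
    + by move=> z /= /mapP[u up ->]; rewrite fP // map_f.
    + move=> y z; rewrite !inE /= => /mapP[u up ->] /mapP[v vp ->].
      rewrite !fP // => /eqP; have [<- _] := pp u v up vp.
      by move/eqP.
    + move=> z /= /mapP[u up ->]; exists u.1; first by rewrite /= map_f.
      by rewrite fP.
  move=> y z /= /mapP[u up ->] /mapP[v vp ->]; rewrite !fP // /slt.
  by have [_ ->] := pp u v up vp.

have gmono y z : (g y < g z) = (y < z).
  by apply/idP/idP => yz; apply/(gm y z).
exists (g x); apply: piso_cons; first exact/pisoP.
move=> u up; have e : g u.1 = u.2.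
  by rewrite -fP // gf //= map_f.
rewrite -e !gmono; split=> //.
by apply/eqP/eqP => [->//|]; apply: ginj; rewrite in_setT.
Qed.

Lemma realizes_types_setT : realizes_types [set: X].
Proof. by move=> F x _ xF; exists x; split=> //; exact: same_type_refl. Qed.

(** The pairs [(f z, z)] over [F] form a finite partial isomorphism; applying [f] to the partner
    that homogeneity gives to [x] lands in [A]. *)
Lemma copy_realizes_types (A : set X) :
  homogeneous X -> copies X A -> realizes_types A.
Proof.
move=> hom [f [[fA finj fsurj] fm]] F x FA xF.
have fmono y z : (f y < f z) = (y < z).
  by apply/idP/idP => yz; apply/(fm y z).
have finj' : injective f by move=> y z; apply: finj; rewrite in_setT.
have [F0 F0P] : exists F0, F = map f F0.
  elim: F FA {xF} => [|a F IH] FA; first by exists [::].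
  have [z _ za] := fsurj a (FA _ (mem_head _ _)).
  have [|F0 ->] := IH; first by move=> g gF; apply: FA; rewrite inE gF orbT.
  by exists (z :: F0); rewrite /= za.
have pp : piso [seq (f z, z) | z <- F0].
  apply/pisoP => u v /mapP[y _ ->] /mapP[z _ ->] /=.
  by rewrite fmono (inj_eq finj').
have [z /piso_consP [_ zP]] := hom _ pp x.
exists (f z); split; first exact: fA.
  rewrite F0P mem_map //; apply: contra xF => zF.
  have [+ _ _] := zP (f z, z) (map_f (fun z => (f z, z)) zF).
  by rewrite /= eqxx => /eqP <-; rewrite F0P map_f.
apply/same_typeP => g; rewrite F0P => /mapP[y yF ->].
have [_ /= -> ->] := zP _ (map_f (fun z => (f z, z)) yF).
by rewrite !fmono.
Qed.

(* Back-and-forth: the back step uses homogeneity of [X], the forth step the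
   richness of [A]. *)
Lemma realizes_types_copy (A : set X) : countable [set: X] ->
  homogeneous X -> realizes_types A -> copies X A.
Proof.
move=> /countable_injP[e einj] hom rA.
have einj' : injective e by move=> x y; apply: einj; rewrite in_setT.
pose code (i : X + {y | A y}) :=
  pickle (match i with inl x => inl (e x) | inr y => inr (e (sval y)) end).
pose D (i : X + {y | A y}) (p : seq (X * X)) :=
  match i with inl x => exists y, (x, y) \in p
             | inr y => exists x, (x, sval y) \in p end.
pose good p := piso p /\ forall u, u \in p -> A u.2.
have [|||G [Gfin GD]] := @generic_filter _ good _ code D.
- move=> [x|[y Ay]] [x'|[y' Ay']] /(pcan_inj pickleK)//= [] /einj'.
    by move=> ->.
  by move=> yy'; subst y'; congr (inr _); apply: eq_exist.
- by split.
- move=> [x|[y Ay]] p [pp pA] /=.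
    case: (boolP (x \in map fst p)) => [/mapP[u up ->]|xp].
      by exists p; split=> //; exists u.2; rewrite -surjective_pairing.
    have [z /piso_consP[_ zP]] := hom p pp x.
    have [||y [Ay yp yz]] := rA (map snd p) z.
    + by move=> f /mapP[u /pA + ->].
    + apply: contra xp => /mapP[u up zu]; have [+ _ _] := zP u up.
      by rewrite zu eqxx => /eqP <-; rewrite map_f.
    exists ((x, y) :: p); split; last by exists y; rewrite mem_head.
      split; last by move=> u; rewrite inE => /orP[/eqP ->//|/pA].
      apply: piso_cons => // u up; have [e1 -> ->] := zP u up.
      have [-> ->] := same_typeP _ _ _ yz u.2 (map_f _ up); split=> //.
      have -> : (u.1 == x) = false.
        by apply: contraNF xp => /eqP <-; rewrite map_f.
      by symmetry; apply: contraNF yp => /eqP <-; rewrite map_f.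
    by move=> u up; rewrite inE up orbT.
  have [x xP] := homogeneous_back hom pp y.
  exists ((x, y) :: p); split; last by exists x; rewrite mem_head.
    by split=> // u; rewrite inE => /orP[/eqP ->//|/pA].
  by move=> u up; rewrite inE up orbT.
have G2 u v : G u -> G v ->
    [/\ (u.1 == v.1) = (u.2 == v.2), (u.1 < v.1) = (u.2 < v.2) & A u.2].
  move=> Gu Gv; have [|p [[/pisoP pp pA] sp _]] := Gfin [:: u; v].
    by move=> w; rewrite !inE => /orP[]/eqP ->.
  have up : u \in p by apply: sp; rewrite !inE eqxx.
  have vp : v \in p by apply: sp; rewrite !inE eqxx orbT.
  by have [-> ->] := pp u v up vp; split=> //; apply: pA.
have /choice[f fP] x : exists y, G (x, y).
  by have [p [_ [y yp] pG]] := GD (inl x); exists y; apply: pG.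
exists f; split; last first.
  by move=> x y _ _; have [_ /= h _] := G2 _ _ (fP x) (fP y); rewrite /slt h.
split.
- by move=> x _; have [_ _] := G2 _ _ (fP x) (fP x).
- move=> x y _ _ /eqP; have [/= <- _ _] := G2 _ _ (fP x) (fP y).
  by move/eqP.
- move=> y Ay; have [p [_ [x /= xp] pG]] := GD (inr (exist _ y Ay)).
  exists x => //; apply/eqP.
  by have [/= <- _ _] := G2 _ _ (fP x) (pG _ xp); rewrite eqxx.
Qed.

End Homogeneity.

(** * Classification of homogeneous posets *)

Definition incomparable (d : Order.disp_t) (X : porderType d) (x y : X) : bool :=
  ~~ (x <= y) && ~~ (y <= x).

(** The extension axioms of the random poset. The three hypotheses are the evident consistency
    conditions for a point above [A], below [B] and incomparable to [C]. *)
Definition extension_property (d : Order.disp_t) (X : porderType d) : Prop :=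
  forall A B C : seq X,
    (forall a b, a \in A -> b \in B -> a < b) ->
    (forall a c, a \in A -> c \in C -> ~~ (c <= a)) ->
    (forall b c, b \in B -> c \in C -> ~~ (b <= c)) ->
    exists x, [/\ forall a, a \in A -> a < x, forall b, b \in B -> x < b &
                  forall c, c \in C -> incomparable x c].

(** Saturation under transitivity, where only new facts are added so that the loop stops, followed
    by a search for a contradictory pair. *)
Ltac order_step := match goal with
  | H : is_true (incomparable _ _) |- _ => move/andP: H => [? ?]
  | H : is_true (?a < ?b), K : is_true (?b < ?c) |- _ =>
    lazymatch goal with _ : is_true (a < c) |- _ => fail
    | _ => have ? : a < c by exact: lt_trans H K end
  | H : is_true (?a <= ?b), K : is_true (?b < ?c) |- _ =>
    lazymatch goal with _ : is_true (a < c) |- _ => fail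
    | _ => have ? : a < c by exact: le_lt_trans H K end
  | H : is_true (?a < ?b), K : is_true (?b <= ?c) |- _ =>
    lazymatch goal with _ : is_true (a < c) |- _ => fail
    | _ => have ? : a < c by exact: lt_le_trans H K end
  | H : is_true (?a <= ?b), K : is_true (?b <= ?c) |- _ =>
    lazymatch goal with _ : is_true (a <= c) |- _ => fail
    | _ => have ? : a <= c by exact: le_trans H K end
  end.
Ltac order_contra := exfalso; match goal with
  | H : is_true (?a < ?a) |- _ => by rewrite ltxx in H
  | H : is_true (?a <= ?b), K : is_true (~~ (?a <= ?b)) |- _ =>
    by rewrite H in K
  | H : is_true (?a < ?b), K : is_true (~~ (?a <= ?b)) |- _ =>
    by rewrite (ltW H) in K
  | K : is_true (~~ (?a <= ?a)) |- _ => by rewrite lexx in K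
  end.
Ltac order :=
  lazymatch goal with
  | |- is_true (incomparable _ _) => apply/andP; split; apply/negP => ?
  | |- is_true (~~ _) => apply/negP => ?
  | _ => idtac end;
  repeat order_step; first [assumption | order_contra].

(** * Transport of configurations of at most four points *)

Section SmallConfigurations.
Context (d : Order.disp_t) (X : porderType d).
Implicit Types a b c x y z u v w : X.

Definition same_rel a b a' b' := [&& (a == b) == (a' == b'),
  (a < b) == (a' < b') & (b < a) == (b' < a')].

Lemma same_rel_lt a b a' b' : a < b -> a' < b' -> same_rel a b a' b'.
Proof.
by move=> h h'; rewrite /same_rel h h' (lt_eqF h) (lt_eqF h') (lt_gtF h)
  (lt_gtF h').
Qed.

Lemma same_rel_gt a b a' b' : b < a -> b' < a' -> same_rel a b a' b'.
Proof.
by move=> h h'; rewrite /same_rel h h' (gt_eqF h) (gt_eqF h') (lt_gtF h)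
  (lt_gtF h').
Qed.

Lemma incomparable_F x y : incomparable x y ->
  [/\ (x == y) = false, (x < y) = false & (y < x) = false].
Proof.
move=> /andP[xy yx]; split.
- by apply: contraNF xy => /eqP ->.
- by apply: contraNF xy => /ltW.
- by apply: contraNF yx => /ltW.
Qed.

Lemma same_rel_inc a b a' b' :
  incomparable a b -> incomparable a' b' -> same_rel a b a' b'.
Proof.
by move=> /incomparable_F[e1 e2 e3] /incomparable_F[f1 f2 f3];
  rewrite /same_rel e1 e2 e3 f1 f2 f3.
Qed.

Lemma rel_lt a b a' b' : same_rel a b a' b' -> a < b -> a' < b'.
Proof. by move=> /and3P[_ /eqP -> _]. Qed.

Lemma rel_gt a b a' b' : same_rel a b a' b' -> b < a -> b' < a'.
Proof. by move=> /and3P[_ _ /eqP ->]. Qed.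

Lemma rel_inc a b a' b' :
  same_rel a b a' b' -> incomparable a b -> incomparable a' b'.
Proof.
by move=> /and3P[/eqP e /eqP f /eqP g]; rewrite /incomparable !le_eqVlt
  -(eq_sym a) -(eq_sym a') e f g.
Qed.

Lemma incomparable_sym x y : incomparable x y = incomparable y x.
Proof. exact: andbC. Qed.

Lemma same_rel_sym a b a' b' : same_rel a b a' b' = same_rel b a b' a'.
Proof.
by rewrite /same_rel (eq_sym a) (eq_sym a') [X in _ && X]andbC.
Qed.

Hypothesis hom : homogeneous X.

(** What occurs over one tuple occurs over every tuple of the same shape. The classification below
    builds one model of each configuration and transports it with this lemma and its analogues for
    two, three and four points. *)
Lemma homogeneous1 a a' x : exists y, same_rel x a y a'.
Proof.
have [|y /piso_consP[_ yP]] := hom (p := [:: (a, a')]) _ x.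
  by rewrite /piso /= !eqxx !ltxx.
exists y; have [] := yP (a, a') (mem_head _ _) => /= e1 e2 e3.
by rewrite same_rel_sym /same_rel e1 e2 e3 !eqxx.
Qed.

Lemma homogeneous2 a b a' b' x : same_rel a b a' b' ->
  exists y, same_rel x a y a' /\ same_rel x b y b'.
Proof.
move=> /and3P[/eqP e1 /eqP e2 /eqP e3].
have [|y /piso_consP[_ yP]] := hom (p := [:: (a, a'); (b, b')]) _ x.
  rewrite /piso /= (eq_sym b a) (eq_sym b' a') !eqxx !ltxx e1 e2 e3.
  by rewrite !eqxx.
exists y; split; rewrite same_rel_sym /same_rel.
  by have [|/= -> -> ->] := yP (a, a'); rewrite ?inE ?eqxx ?orbT.
by have [|/= -> -> ->] := yP (b, b'); rewrite ?inE ?eqxx ?orbT.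
Qed.

Lemma homogeneous3 a b c a' b' c' x :
  same_rel a b a' b' -> same_rel a c a' c' -> same_rel b c b' c' ->
  exists y, [/\ same_rel x a y a', same_rel x b y b' & same_rel x c y c'].
Proof.
move=> /and3P[/eqP e1 /eqP e2 /eqP e3] /and3P[/eqP f1 /eqP f2 /eqP f3].
move=> /and3P[/eqP g1 /eqP g2 /eqP g3].
have [|y /piso_consP[_ yP]] := hom (p := [:: (a, a'); (b, b'); (c, c')]) _ x.
  rewrite /piso /= -(eq_sym a b) -(eq_sym a' b') -(eq_sym a c) -(eq_sym a' c').
  rewrite -(eq_sym b c) -(eq_sym b' c').
  by rewrite !eqxx !ltxx e1 e2 e3 f1 f2 f3 g1 g2 g3 !eqxx.
exists y; split; rewrite same_rel_sym /same_rel.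
- by have [|/= -> -> ->] := yP (a, a'); rewrite ?inE ?eqxx ?orbT.
- by have [|/= -> -> ->] := yP (b, b'); rewrite ?inE ?eqxx ?orbT.
- by have [|/= -> -> ->] := yP (c, c'); rewrite ?inE ?eqxx ?orbT.
Qed.

Lemma homogeneous4 a b c e a' b' c' e' x :
  same_rel a b a' b' -> same_rel a c a' c' -> same_rel b c b' c' ->
  same_rel a e a' e' -> same_rel b e b' e' -> same_rel c e c' e' ->
  exists y, [/\ same_rel x a y a', same_rel x b y b', same_rel x c y c' &
                same_rel x e y e'].
Proof.
move=> /and3P[/eqP e1 /eqP e2 /eqP e3] /and3P[/eqP f1 /eqP f2 /eqP f3].
move=> /and3P[/eqP g1 /eqP g2 /eqP g3] /and3P[/eqP h1 /eqP h2 /eqP h3].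
move=> /and3P[/eqP i1 /eqP i2 /eqP i3] /and3P[/eqP j1 /eqP j2 /eqP j3].
have [|y /piso_consP[_ yP]] :=
    hom (p := [:: (a, a'); (b, b'); (c, c'); (e, e')]) _ x.
  rewrite /piso /= -(eq_sym a b) -(eq_sym a' b') -(eq_sym a c) -(eq_sym a' c').
  rewrite -(eq_sym b c) -(eq_sym b' c') -(eq_sym a e) -(eq_sym a' e').
  rewrite -(eq_sym b e) -(eq_sym b' e') -(eq_sym c e) -(eq_sym c' e').
  rewrite !eqxx !ltxx e1 e2 e3 f1 f2 f3 g1 g2 g3 h1 h2 h3 i1 i2 i3 j1 j2 j3.
  by rewrite !eqxx.
exists y; split; rewrite same_rel_sym /same_rel.
- by have [|/= -> -> ->] := yP (a, a'); rewrite ?inE ?eqxx ?orbT.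
- by have [|/= -> -> ->] := yP (b, b'); rewrite ?inE ?eqxx ?orbT.
- by have [|/= -> -> ->] := yP (c, c'); rewrite ?inE ?eqxx ?orbT.
- by have [|/= -> -> ->] := yP (e, e'); rewrite ?inE ?eqxx ?orbT.
Qed.

End SmallConfigurations.

Lemma homogeneous_dual (d : Order.disp_t) (X : porderType d) :
  homogeneous X -> homogeneous X^d.
Proof.
have dual (p : seq (X * X)) : @piso _ X^d p = piso p.
  by apply/pisoP/pisoP => h u v up vp; have [-> _] := h u v up vp;
    have [_ e] := h v u vp up.
move=> hom p; rewrite (dual p) => pp x.
by have [y yP] := hom p pp x; exists y; rewrite (dual ((x, y) :: p)).
Qed.

Section Comparabilities.
Context (d : Order.disp_t) (X : porderType d).
Hypothesis hom : homogeneous X.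
Hypothesis nonantichain : exists a b : X, a < b.
Implicit Types a b c x y z u v w : X.

Lemma homogeneous_up x : exists y, x < y.
Proof.
have [a [b ab]] := nonantichain.
by have [y yP] := homogeneous1 hom a x b; exists y; apply: rel_gt yP ab.
Qed.

Lemma homogeneous_down x : exists y, y < x.
Proof.
have [a [b ab]] := nonantichain.
by have [y yP] := homogeneous1 hom b x a; exists y; apply: rel_lt yP ab.
Qed.

Lemma homogeneous_dense x y : x < y -> exists z, x < z /\ z < y.
Proof.
move=> xy; have [a [b ab]] := nonantichain; have [c bc] := homogeneous_up b.
have [z [za zc]] := homogeneous2 hom b (same_rel_lt (lt_trans ab bc) xy).
by exists z; split; [exact: rel_gt za ab | exact: rel_lt zc bc].
Qed.

(** Without a fork, the points above any given point form a chain. Moving the cofork onto [a < c]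
    gives [e < c] incomparable to [a], and then [a], [b], [e] is an antichain. Exchanging [b] and
    [e] takes [c] to some [c'] above [a] and [b] but incomparable to [e]; now [c] and [c'] are
    incomparable and both above [a]. *)
Lemma Lambda_V :
  (exists a b c, [/\ a < c, incomparable a b & incomparable b c]) ->
  (exists u v w, [/\ incomparable u v, u < w & v < w]) ->
  exists u v w, [/\ incomparable u v, w < u & w < v].
Proof.
move=> [a [b [c [ac ab bc]]]] [u [v [w [uv uw vw]]]].
apply: contrapT => noV.
have tree x y z : x < y -> x < z -> ~~ incomparable y z.
  by move=> xy xz; apply/negP => yz; apply: noV; exists y, z, x.
have [e [ea ec]] := homogeneous2 hom v (same_rel_lt uw ac).
have {}ea : incomparable e a.
  by apply: rel_inc ea _; rewrite incomparable_sym.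
have {}ec := rel_lt ec vw.
have eb : incomparable e b.
  apply/andP; split; apply/negP => h; last by order.
  have eb : e < b.
    by rewrite lt_neqAle h andbT; apply/negP => /eqP ?; subst e; order.
  by have /negP := tree _ _ _ eb ec; apply.
have ae : incomparable a e by rewrite incomparable_sym.
have be : incomparable b e by rewrite incomparable_sym.
have [c' [ca' ce' cb']] := homogeneous3 hom c (same_rel_inc ae ab)
   (same_rel_inc ab ae) (same_rel_inc eb be).
have {}ca' := rel_gt ca' ac; have {}ce' := rel_gt ce' ec.
have {}cb' : incomparable c' e.
  by apply: rel_inc cb' _; rewrite incomparable_sym.
have /negP := tree _ _ _ ac ca'; apply; order.
Qed.

End Comparabilities.

(** The three-point posets 2+1, cofork and fork. Together with homogeneity they already force the
    random poset. *)
Definition mixed (d : Order.disp_t) (X : porderType d) : Prop :=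
  [/\ exists a b c : X, [/\ a < c, incomparable a b & incomparable b c],
      exists u v w : X, [/\ incomparable u v, u < w & v < w] &
      exists u v w : X, [/\ incomparable u v, w < u & w < v]].

Lemma mixed_dual (d : Order.disp_t) (X : porderType d) : mixed X -> mixed X^d.
Proof.
have idual (x y : X) : @incomparable _ X^d x y = incomparable x y.
  by rewrite /incomparable andbC.
move=> [[a [b [c [ac ab bc]]]] [u [v [w [uv uw vw]]]] [u' [v' [w' [uv' uw' vw']]]]].
split.
- by exists c, b, a; split; rewrite // idual incomparable_sym.
- by exists u', v', w'; rewrite idual.
- by exists u, v, w; rewrite idual.
Qed.

(** The hypotheses say that neither incomparability nor comparability is transitive. A failure of
    the latter is a fork or a cofork, and [Lambda_V] or its dual supplies the other one. *)
Lemma mixedP (d : Order.disp_t) (X : porderType d) : homogeneous X ->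
  (exists a b c : X, [/\ a < c, incomparable a b & incomparable b c]) ->
  (exists a b c : X, [/\ ~~ incomparable a b, ~~ incomparable b c &
     incomparable a c]) -> mixed X.
Proof.
move=> hom N [a [b [c [ab bc ac]]]].
have nonanti : exists a b : X, a < b.
  by have [x [_ [y [xy _ _]]]] := N; exists x, y.
have dual : (exists u v w : X, [/\ incomparable u v, w < u & w < v]) ->
    exists u v w : X, [/\ incomparable u v, u < w & v < w].
  move=> [u [v [w [uv uw vw]]]].
  have idual (x y : X) : @incomparable _ X^d x y = incomparable x y.
    by rewrite /incomparable andbC.
  have [||u' [v' [w' [uv' uw' vw']]]] :=
      @Lambda_V _ X^d (homogeneous_dual hom).
  - have [x [y [z [xz xy yz]]]] := N.
    by exists z, y, x; split; rewrite // idual incomparable_sym.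
  - by exists u, v, w; rewrite idual.
  - by exists u', v', w'; rewrite -idual.
have cmp (x y : X) : ~~ incomparable x y -> x <= y \/ y <= x.
  by rewrite negb_and !negbK => /orP.
have [ab'|ab'] := cmp _ _ ab; have [bc'|bc'] := cmp _ _ bc.
- by order.
- have Lam : exists u v w : X, [/\ incomparable u v, u < w & v < w].
    exists a, c, b; split=> //; rewrite lt_neqAle ?ab' ?bc' andbT;
      by apply/negP => /eqP ?; subst b; order.
  by split => //; exact: Lambda_V.
- have V : exists u v w : X, [/\ incomparable u v, w < u & w < v].
    exists a, c, b; split=> //; rewrite lt_neqAle ?ab' ?bc' andbT;
      by apply/negP => /eqP ?; subst b; order.
  by split => //; exact: dual.
- by order.
Qed.

(** * Amalgamation in posets that contain 2+1, forks and coforks *)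

Section Mixed.
Context (d : Order.disp_t) (X : porderType d).
Hypothesis hom : homogeneous X.
Hypothesis mixX : mixed X.
Implicit Types (a b c p x y z u v w : X) (A B C : seq X).

Let nonantichain : exists a b : X, a < b.
Proof. by have [[x [_ [y [xy _ _]]]] _ _] := mixX; exists x, y. Qed.

Let up := homogeneous_up hom nonantichain.
Let down := homogeneous_down hom nonantichain.
Let dense := homogeneous_dense hom nonantichain.

Lemma mixed_above x y : incomparable x y -> exists z, x < z /\ y < z.
Proof.
move=> xy; have [_ [u [v [w [uv uw vw]]]] _] := mixX.
have [z [zu zv]] := homogeneous2 hom w (same_rel_inc uv xy).
by exists z; split; [exact: rel_gt zu uw | exact: rel_gt zv vw].
Qed.

Lemma mixed_below x y : incomparable x y -> exists z, z < x /\ z < y.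
Proof.
move=> xy; have [_ _ [u [v [w [uv uw vw]]]]] := mixX.
have [z [zu zv]] := homogeneous2 hom w (same_rel_inc uv xy).
by exists z; split; [exact: rel_lt zu uw | exact: rel_lt zv vw].
Qed.

Lemma mixed_incomparable x y : x < y ->
  exists z, incomparable z x /\ incomparable z y.
Proof.
move=> xy; have [[a [b [c [ac ab bc]]]] _ _] := mixX.
have [z [za zc]] := homogeneous2 hom b (same_rel_lt ac xy).
exists z; split; last exact: rel_inc zc bc.
by apply: rel_inc za _; rewrite incomparable_sym.
Qed.

Lemma mixed_up_incomparable x y : incomparable x y ->
  exists z, x < z /\ incomparable z y.
Proof.
move=> xy; have [[a [b [c [ac ab bc]]]] _ _] := mixX.
have [z [za zc]] := homogeneous2 hom c (same_rel_inc ab xy).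
exists z; split; first exact: rel_gt za ac.
by apply: rel_inc zc _; rewrite incomparable_sym.
Qed.

Lemma mixed_down_incomparable x y : incomparable x y ->
  exists z, z < x /\ incomparable z y.
Proof.
move=> xy; have [[a [b [c [ac ab bc]]]] _ _] := mixX.
rewrite incomparable_sym in bc.
have [z [za zc]] := homogeneous2 hom a (same_rel_inc bc xy).
by exists z; split; [exact: rel_lt za ac | exact: rel_inc zc ab].
Qed.

Lemma mixed_fork x z : x < z -> exists y, x < y /\ incomparable y z.
Proof.
move=> xz; have [_ _ [u [v [w [uv uw vw]]]]] := mixX.
have [y [ya yc]] := homogeneous2 hom u (same_rel_lt vw xz).
by exists y; split; [exact: rel_gt ya uw | exact: rel_inc yc uv].
Qed.

Lemma mixed_diamond x y z : x < y -> y < z ->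
  exists t, [/\ x < t, t < z & incomparable t y].
Proof.
move=> xy yz; have [_ [u [v [w [uv uw vw]]]] _] := mixX.
have [t [tu tv]] := mixed_below uv.
have [s [sx sy sz]] := homogeneous3 hom v (same_rel_lt tu xy)
  (same_rel_lt (lt_trans tu uw) (lt_trans xy yz)) (same_rel_lt uw yz).
exists s; split; [exact: rel_gt sx tv | exact: rel_lt sz vw |].
by apply: rel_inc sy _; rewrite incomparable_sym.
Qed.

(** The model lies in an interval: [w] is incomparable to both ends of [v0 < u], hence to everything
    between them, in particular to the two middle points [z0] and [y0] of a diamond. *)
Lemma mixed_V_plus_1 x y z :
  incomparable x y -> incomparable z x -> incomparable z y ->
  exists p, [/\ p < x, p < y & incomparable p z].
Proof.
move=> xy zx zy; have [v0 [z0 vz]] := nonantichain.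
have [w [wv wz]] := mixed_incomparable vz.
have [|u [zu uw]] := @mixed_up_incomparable z0 w.
  by rewrite incomparable_sym.
have [y0 [vy yu yz]] := mixed_diamond vz zu.
have wy : incomparable w y0 by order.
have zy0 : incomparable z0 y0 by rewrite incomparable_sym.
have [p [pz pw py]] := homogeneous3 hom v0
  (same_rel_inc (etrans (incomparable_sym _ _) wz)
    (etrans (incomparable_sym _ _) zx))
  (same_rel_inc zy0 xy) (same_rel_inc wy zy).
exists p; split; [exact: rel_lt pz vz | exact: rel_lt py vy |].
by apply: rel_inc pw _; rewrite incomparable_sym.
Qed.


Lemma mixed_antichain3 : exists x y z,
  [/\ incomparable x y, incomparable z x & incomparable z y].
Proof.
have [v0 [z0 vz]] := nonantichain.
have [w [wv wz]] := mixed_incomparable vz.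
have [|u [zu uw]] := @mixed_up_incomparable z0 w.
  by rewrite incomparable_sym.
have [y0 [vy yu yz]] := mixed_diamond vz zu.
by exists y0, z0, w; split => //; order.
Qed.

(** Over an antichain [p], [b], [c] take [a] below [b] and [c] only, and its mirror image [a'] under
    the exchange of [p] and [c]. A comparability of [a] with [a'] would put one of them below a
    point it must avoid. *)
Lemma mixed_N : exists p b a c, [/\ p < b, a < b, a < c &
  [/\ incomparable p a, incomparable p c & incomparable b c]].
Proof.
have [b [c [p [bc pb pc]]]] := mixed_antichain3.
have [a [ab ac ap]] := mixed_V_plus_1 bc pb pc.
have cp : incomparable c p by rewrite incomparable_sym.
have cb : incomparable c b by rewrite incomparable_sym.
have bp : incomparable b p by rewrite incomparable_sym.
have [a' [a'c a'b a'p]] := homogeneous3 hom a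
  (same_rel_inc pb cb) (same_rel_inc pc cp) (same_rel_inc bc bp).
have {}a'c := rel_inc a'c ap; have {}a'b := rel_lt a'b ab.
have {}a'p := rel_lt a'p ac.
by exists a', b, a, c; split => //; split => //; order.
Qed.

Lemma mixed_N_tail x y z : x < y -> x < z -> incomparable y z ->
  exists p, [/\ p < y, incomparable p x & incomparable p z].
Proof.
move=> xy xz yz.
have [p [b [a [c [pb ab ac [pa pc bc]]]]]] := mixed_N.
have [q [qa qb qc]] := homogeneous3 hom p (same_rel_lt ab xy)
  (same_rel_lt ac xz) (same_rel_inc bc yz).
by exists q; split; [exact: rel_lt qb pb | exact: rel_inc qa pa |
  exact: rel_inc qc pc].
Qed.

Lemma mixed_N_middle x y z : x < y -> incomparable x z -> incomparable y z ->
  exists p, [/\ p < y, p < z & incomparable p x].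
Proof.
move=> xy xz yz.
have [p [b [a [c [pb ab ac [pa pc bc]]]]]] := mixed_N.
have [q [qp qb qc]] := homogeneous3 hom a (same_rel_lt pb xy)
  (same_rel_inc pc xz) (same_rel_inc bc yz).
exists q; split; [exact: rel_lt qb ab | exact: rel_lt qc ac |].
by apply: rel_inc qp _; rewrite incomparable_sym.
Qed.

Lemma mixed_between_fork x y z : x < y -> x < z -> incomparable y z ->
  exists p, [/\ x < p, p < y & p < z].
Proof.
move=> xy xz yz; have [_ _ [u [v [w [uv uw vw]]]]] := mixX.
have [t tw] := down w.
have [q [qt qu qv]] := homogeneous3 hom w (same_rel_lt (lt_trans tw uw) xy)
  (same_rel_lt (lt_trans tw vw) xz) (same_rel_inc uv yz).
by exists q; split; [exact: rel_gt qt tw | exact: rel_lt qu uw |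
  exact: rel_lt qv vw].
Qed.

Lemma mixed_between_cofork x y z : y < x -> z < x -> incomparable y z ->
  exists p, [/\ p < x, y < p & z < p].
Proof.
move=> yx zx yz; have [p [yp zp]] := mixed_above yz.
have [t pt] := up p.
have [q [qt qu qv]] := homogeneous3 hom p (same_rel_gt (lt_trans yp pt) yx)
  (same_rel_gt (lt_trans zp pt) zx) (same_rel_inc yz yz).
by exists q; split; [exact: rel_lt qt pt | exact: rel_gt qu yp |
  exact: rel_gt qv zp].
Qed.

(** The model is [x], [y] below [w] with a fork [s], [t] over [w]; homogeneity on four points fixes
    [x], [y] and moves [s], [t] to [u], [v]. *)
Lemma mixed_between22 x y u v : incomparable x y -> incomparable u v ->
  x < u -> x < v -> y < u -> y < v ->
  exists p, [/\ x < p, y < p, p < u & p < v].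
Proof.
move=> xy uv xu xv yu yv.
have [w [xw yw]] := mixed_above xy.
have [s ws] := up w; have [t [wt ts]] := mixed_fork ws.
have st : incomparable s t by rewrite incomparable_sym.
have [q [qx qy qu qv]] := homogeneous4 hom w (same_rel_inc xy xy)
  (same_rel_lt (lt_trans xw ws) xu) (same_rel_lt (lt_trans yw ws) yu)
  (same_rel_lt (lt_trans xw wt) xv) (same_rel_lt (lt_trans yw wt) yv)
  (same_rel_inc st uv).
by exists q; split; [exact: rel_gt qx xw | exact: rel_gt qy yw |
  exact: rel_lt qu ws | exact: rel_lt qv wt].
Qed.

(** Induction on [B]: the bound found so far is combined with the next point, so a finite set of
    constraints reduces to a single point or an incomparable pair. *)
Lemma lower_bound_reduce (P : X -> Prop) B :
  (forall b, P b -> exists q, P q /\ q < b) ->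
  (forall b b', P b -> P b' -> incomparable b b' ->
     exists q, [/\ P q, q < b & q < b']) ->
  (exists q, P q) -> (forall b, b \in B -> P b) ->
  exists q, P q /\ forall b, b \in B -> q < b.
Proof.
move=> P1 P2 P0; elim: B => [|b B IH] BP.
  by have [q Pq] := P0; exists q.
have [|q [Pq qB]] := IH; first by move=> c cB; apply: BP; rewrite inE cB orbT.
have Pb : P b by apply: BP; rewrite mem_head.
suff [r [Pr rq rb]] : exists r, [/\ P r, r <= q & r < b].
  exists r; split=> // c; rewrite inE => /orP[/eqP -> //|/qB].
  exact: le_lt_trans.
have [qb|] := boolP (incomparable q b).
  by have [r [Pr /ltW rq rb]] := P2 _ _ Pq Pb qb; exists r.
rewrite negb_and !negbK => /orP[qb|bq].
  have [r [Pr rq]] := P1 _ Pq; exists r; split=> //; first exact: ltW.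
  exact: lt_le_trans qb.
have [r [Pr rb]] := P1 _ Pb; exists r; split=> //.
exact/ltW/(lt_le_trans rb).
Qed.

Lemma upper_bound_reduce (P : X -> Prop) A :
  (forall a, P a -> exists q, P q /\ a < q) ->
  (forall a a', P a -> P a' -> incomparable a a' ->
     exists q, [/\ P q, a < q & a' < q]) ->
  (exists q, P q) -> (forall a, a \in A -> P a) ->
  exists q, P q /\ forall a, a \in A -> a < q.
Proof.
move=> P1 P2 P0; elim: A => [|a A IH] AP.
  by have [q Pq] := P0; exists q.
have [|q [Pq qA]] := IH; first by move=> c cA; apply: AP; rewrite inE cA orbT.
have Pa : P a by apply: AP; rewrite mem_head.
suff [r [Pr rq ra]] : exists r, [/\ P r, q <= r & a < r].
  exists r; split=> // c; rewrite inE => /orP[/eqP -> //|/qA cq].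
  exact: lt_le_trans rq.
have [qa|] := boolP (incomparable q a).
  by have [r [Pr /ltW rq rb]] := P2 _ _ Pq Pa qa; exists r.
rewrite negb_and !negbK => /orP[qa|aq].
  have [r [Pr ra]] := P1 _ Pa; exists r; split=> //.
  exact/ltW/(le_lt_trans qa).
have [r [Pr rq]] := P1 _ Pq; exists r; split=> //; first exact: ltW.
exact: le_lt_trans rq.
Qed.

Lemma between2 x y B : incomparable x y ->
  (forall b, b \in B -> x < b) -> (forall b, b \in B -> y < b) ->
  exists q, [/\ x < q, y < q & forall b, b \in B -> q < b].
Proof.
move=> xy xB yB.
have [||||q [[xq yq] qB]] := @lower_bound_reduce (fun z => x < z /\ y < z) B.
- move=> b [xb yb]; have [q [qb xq yq]] := mixed_between_cofork xb yb xy.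
  by exists q.
- move=> b b' [xb yb] [xb' yb'] bb'.
  by have [q [qx qy qb qb']] := mixed_between22 xy bb' xb xb' yb yb'; exists q.
- by have [z [xz yz]] := mixed_above xy; exists z.
- by move=> b bB; split; [exact: xB | exact: yB].
- by exists q.
Qed.

Lemma between1 x B : (forall b, b \in B -> x < b) ->
  exists q, x < q /\ forall b, b \in B -> q < b.
Proof.
move=> xB; apply: (@lower_bound_reduce (fun z => x < z)) => //.
- by move=> b /dense[q [xq qb]]; exists q.
- move=> b b' xb xb' bb'.
  by have [q [xq qb qb']] := mixed_between_fork xb xb' bb'; exists q.
Qed.

Lemma between A B : (forall a b, a \in A -> b \in B -> a < b) ->
  exists x, (forall a, a \in A -> a < x) /\ (forall b, b \in B -> x < b).
Proof.
move=> AB.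
have [||||q [qB qA]] :=
    @upper_bound_reduce (fun z => forall b, b \in B -> z < b) A.
- by move=> a /between1[q [aq qB]]; exists q.
- by move=> a a' aB aB' aa'; have [q []] := between2 aa' aB aB'; exists q.
- have [||||q [_ qB]] := @lower_bound_reduce (fun=> True) B.
  + by move=> b _; have [q qb] := down b; exists q.
  + by move=> b b' _ _ /mixed_below[q [qb qb']]; exists q.
  + by have [z _] := nonantichain; exists z.
  + by [].
  + by exists q.
- by move=> a aA b; apply: AB.
- by exists q.
Qed.

(** A point not below [c] is above [c] or incomparable to it. The four cases for a pair are
    interpolation above [c], the N configuration twice, and a fork plus an isolated point. *)
Lemma lower_bound_not_le B c : (forall b, b \in B -> ~~ (b <= c)) ->
  exists p, ~~ (p <= c) /\ forall b, b \in B -> p < b.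
Proof.
have down1 b : ~~ (b <= c) -> exists q, ~~ (q <= c) /\ q < b.
  move=> bc; have [cb|cb] := boolP (c < b).
    have [q [cq qb]] := dense cb; exists q; split => //; order.
  have [|q [qb /andP[qc _]]] := @mixed_down_incomparable b c.
    rewrite /incomparable bc /= le_eqVlt negb_or cb andbT.
    by apply: contra bc => /eqP ->.
  by exists q.
apply: lower_bound_reduce => // [b b' bc bc' bb'|]; last first.
  by have [q cq] := up c; exists q; order.
have inc z : ~~ (z <= c) -> ~~ (c < z) -> incomparable c z.
  move=> h k; rewrite /incomparable h andbT le_eqVlt negb_or k andbT.
  by apply: contra h => /eqP ->.
have b'b : incomparable b' b by rewrite incomparable_sym.
have [cb|/(inc _ bc) cb] := boolP (c < b);
  have [cb'|/(inc _ bc') cb'] := boolP (c < b').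
- have [q [cq qb qb']] := mixed_between_fork cb cb' bb'.
  by exists q; split => //; order.
- by have [q [qb qb' /andP[]]] := mixed_N_middle cb cb' bb'; exists q.
- by have [q [qb qb' /andP[]]] := mixed_N_middle cb' cb b'b; exists q.
- by have [q [qb qb' /andP[]]] := mixed_V_plus_1 bb' cb cb'; exists q.
Qed.

(** The points of [C] not below [c] are treated as members of [B]: being below them suffices. For
    those below [c] a common strict lower bound [c0] is chosen, and it suffices that the result is
    not above [c0]. *)
Lemma lower_bound_not_above B C c : (forall b, b \in B -> ~~ (b <= c)) ->
  exists p, [/\ ~~ (p <= c), forall b, b \in B -> p < b &
    forall c', c' \in C -> ~~ (c' <= p)].
Proof.
move=> Bc.
have [c0 c0P] : exists c0, forall x, x \in c :: [seq x <- C | x <= c] -> c0 < x.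
  have [|x [_ xP]] := @between [::] (c :: [seq x <- C | x <= c]).
    by [].
  by exists x.
have c0c : c0 < c by apply: c0P; rewrite mem_head.
have [|p [pc pB]] := @lower_bound_not_le (B ++ [seq x <- C | ~~ (x <= c)]) c.
  move=> b; rewrite mem_cat => /orP[/Bc//|]; by rewrite mem_filter => /andP[].
have [q [qp qc c0q]] : exists q, [/\ q <= p, ~~ (q <= c) & ~~ (c0 <= q)].
  have [c0p|c0p] := boolP (c0 <= p); last by exists p.
  have {}c0p : c0 < p.
    by rewrite lt_neqAle c0p andbT; apply: contra pc => /eqP <-; apply: ltW.
  have [cp|cp] := boolP (c < p).
    have [q [qc0 qc]] := mixed_incomparable c0c.
    have pc0c : same_rel c0 c c0 c by apply: same_rel_lt.
    have [z [cz zq]] : exists z, c < z /\ q < z.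
      by apply: mixed_above; rewrite incomparable_sym.
    have [r [r0 r1 r2]] := homogeneous3 hom q pc0c
      (same_rel_lt (lt_trans c0c cz) c0p) (same_rel_lt cz cp).
    have rc := rel_inc r1 qc; have rc0 := rel_inc r0 qc0.
    by exists r; split; [exact/ltW/(rel_lt r2 zq) | by case/andP: rc |
      by case/andP: rc0].
  have pc' : incomparable p c.
    rewrite /incomparable pc /= le_eqVlt negb_or cp andbT.
    by apply: contra pc => /eqP ->.
  have [q [qp qc0 qc]] := mixed_N_tail c0p c0c pc'.
  by exists q; split; [exact: ltW | by case/andP: qc | by case/andP: qc0].
exists q; split=> //.
  by move=> b bB; apply: le_lt_trans qp _; apply: pB; rewrite mem_cat bB.
move=> c' c'C; have [c'c|c'c] := boolP (c' <= c).
  have c0c' : c0 < c' by apply: c0P; rewrite inE mem_filter c'c c'C orbT.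
  by order.
have qc' : p < c' by apply: pB; rewrite mem_cat mem_filter c'c c'C orbT.
by order.
Qed.

End Mixed.

(** Incomparability is turned into interpolation: [p c] is not below [c], so putting it under [x]
    prevents [x <= c], and dually [q c] over [x] prevents [c <= x]. The choices must be compatible,
    every [p c] lying below [B] and all [q c'], and every [q c] above [A]; hence the extra clauses
    of the preceding lemmas. *)
Lemma mixed_extension_property (d : Order.disp_t) (X : porderType d) :
  homogeneous X -> mixed X -> extension_property X.
Proof.
move=> hom mix A B C AB AC BC.
have /choice[p pP] c : exists p, c \in C -> [/\ ~~ (p <= c),
    forall b, b \in B -> p < b & forall c', c' \in C -> ~~ (c' <= p)].
  have [cC|cC] := boolP (c \in C); last by exists c.
  have [|p pP] := @lower_bound_not_above _ _ hom mix B C c.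
    by move=> b bB; apply: BC.
  by exists p.
pose A' := A ++ map p C.
have /choice[q qP] c : exists q, c \in C -> ~~ (c <= q) /\
    forall a, a \in A' -> a < q.
  have [cC|cC] := boolP (c \in C); last by exists c.
  have [|q qP] := @lower_bound_not_le _ X^d (homogeneous_dual hom)
      (mixed_dual mix) A' c; last by exists q.
  move=> a; rewrite mem_cat => /orP[aA|/mapP[c' c'C ->]].
    exact: (AC a c aA cC).
  by have [_ _ h] := pP c' c'C; exact: (h c cC).
have [|x [Ax xB]] := @between _ X hom mix A' (B ++ map q C).
  move=> a b aA'; rewrite mem_cat => /orP[bB|/mapP[c cC ->]].
    move: aA'; rewrite mem_cat => /orP[aA|/mapP[c cC ->]]; first exact: AB.
    by have [_ h _] := pP c cC; apply: h.
  by have [_ h] := qP c cC; apply: h.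
exists x; split.
- by move=> a aA; apply: Ax; rewrite mem_cat aA.
- by move=> b bB; apply: xB; rewrite mem_cat bB.
- move=> c cC; have [pc _ _] := pP c cC; have [cq _] := qP c cC.
  have px : p c < x by apply: Ax; rewrite mem_cat map_f ?orbT.
  have xq : x < q c by apply: xB; rewrite mem_cat map_f ?orbT.
  by order.
Qed.

(** A coarse form of Schmerl's classification: disjoint unions of chains (antichains included),
    orders whose levels are linearly ordered, and the random poset. *)
Lemma homogeneous_trichotomy (d : Order.disp_t) (X : porderType d) :
  homogeneous X ->
  [\/ forall x y z : X, ~~ incomparable x y -> ~~ incomparable y z ->
        ~~ incomparable x z,
      forall x y z : X, (x == y) || incomparable x y ->
        (y == z) || incomparable y z -> (x == z) || incomparable x z |
      extension_property X].
Proof.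
move=> hom.
have [Q|nQ] := pselect (forall x y z : X, ~~ incomparable x y ->
  ~~ incomparable y z -> ~~ incomparable x z); first by constructor 1.
have [Q'|nQ'] := pselect (forall x y z : X, (x == y) || incomparable x y ->
        (y == z) || incomparable y z -> (x == z) || incomparable x z).
  by constructor 2.
constructor 3; apply: mixed_extension_property => //; apply: mixedP => //.
  apply: contrapT => no; apply: nQ' => x y z /orP[/eqP -> //|xy].
  move=> /orP[/eqP <-|yz]; first by rewrite xy orbT.
  have [xz|xz] := boolP (incomparable x z); first by rewrite orbT.
  move: xz; rewrite orbF negb_and !negbK !le_eqVlt (eq_sym z).
  case: (x == z) => //= /orP[xz|zx]; exfalso; apply: no.
    by exists x, y, z.
  by exists z, y, x; split => //; rewrite incomparable_sym.
apply: contrapT => no; apply: nQ => x y z xy yz; apply/negP => xz.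
by apply: no; exists x, y, z.
Qed.

(** * Generic labellings *)

(** The type is taken over [F'], whereas the larger [F] only has to be avoided; so each type has
    infinitely many realizations. *)
Definition nonalgebraic (d : Order.disp_t) (X : porderType d) (W : set X) :
    Prop :=
  forall (F F' : seq X) (x : X), {subset F' <= F} -> (forall f, f \in F -> W f) ->
    W x -> x \notin F' -> exists y, [/\ W y, y \notin F & same_type F' x y].

(** In the application [G] consists of elements whose labels in [D] are too large: an element above
    one of them would inherit an even larger label. The last hypothesis excludes that the type over
    [F'] itself forces such a position. *)
Definition escapes (d : Order.disp_t) (X : porderType d) (W : set X) : Prop :=
  forall (F F' G : seq X) (x : X), {subset F' <= F} -> {subset G <= F} ->
    (forall f, f \in F -> W f) -> W x -> x \notin F' ->
    (forall g f, g \in G -> f \in F' -> ~~ (g <= f)) ->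
    exists y, [/\ W y, y \notin F, same_type F' x y &
                  forall g, g \in G -> ~~ (g <= y)].

Lemma seq_max (d : Order.disp_t) (T : orderType d) (x : T) (s : seq T) :
  exists m, m \in x :: s /\ forall y, y \in x :: s -> y <= m.
Proof.
elim: s x => [|y s IH] x; first by exists x; split => [|y]; rewrite inE => // /eqP ->.
have [m [ms mP]] := IH y; have [mx|xm] := leP m x.
  exists x; split => [|z]; first exact: mem_head.
  by rewrite inE => /orP[/eqP -> //|/mP zm]; apply: le_trans mx.
exists m; split => [|z]; first by rewrite inE ms orbT.
by rewrite inE => /orP[/eqP ->|/mP //]; apply: ltW.
Qed.

Lemma seq_lower_bound (d : Order.disp_t) (T : orderType d) (m t : T) (s : seq T) :
  m < t -> exists u, [/\ m < u, u <= t & forall y, y \in s -> m < y -> u <= y].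
Proof.
move=> mt; elim: s => [|y s [u [mu ut uP]]]; first by exists t; split.
have [my|ym] := ltP m y; last first.
  exists u; split=> // z; rewrite inE => /orP[/eqP ->|/uP //].
  by rewrite ltNge ym.
exists (Order.min u y); split.
- by rewrite lt_min mu my.
- by rewrite ge_min ut.
- move=> z; rewrite inE => /orP[/eqP ->|/uP h /h uz].
    by rewrite ge_min lexx orbT.
  by rewrite ge_min uz.
Qed.

Lemma seq_maximal (d : Order.disp_t) (T : porderType d) (s : seq T) :
  s != [::] -> exists m, m \in s /\ forall y, y \in s -> ~~ (m < y).
Proof.
elim: s => // x s IH _; have [->|/IH[m [ms mP]]] := eqVneq s [::].
  by exists x; split=> [|y]; rewrite inE // => /eqP ->; rewrite ltxx.
have [mx|mx] := boolP (m < x).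
  exists x; split=> [|y]; first exact: mem_head.
  rewrite inE => /orP[/eqP ->|/mP my]; first by rewrite ltxx.
  by apply: contra my; apply: lt_trans.
exists m; split=> [|y]; first by rewrite inE ms orbT.
by rewrite inE => /orP[/eqP ->|/mP].
Qed.

Lemma escapes_nonalgebraic (d : Order.disp_t) (X : porderType d) (W : set X) :
  escapes W -> nonalgebraic W.
Proof.
move=> esc F F' x F'F FW Wx xF'.
by have [||y [Wy yF xy _]] := esc F F' [::] x F'F _ FW Wx xF' _; last by exists y.
Qed.

(** The new point is made incomparable to every member of [F] whose comparability is not forced by
    the type over [F']. Being above some [g] would then require [g <= a < x] with [a] in [F'], which
    is excluded. *)
Lemma extension_property_escapes (d : Order.disp_t) (X : porderType d) :
  extension_property X -> escapes [set: X].
Proof.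
move=> ext F F' G x F'F GF _ _ xF' GF'.
pose below y := has (fun a => (a < x) && (y <= a)) F'.
pose above y := has (fun a => (x < a) && (a <= y)) F'.
have [|||y [yA yB yC]] := ext [seq y <- F | below y] [seq y <- F | above y]
    [seq y <- F | ~~ below y && ~~ above y].
- move=> a b; rewrite !mem_filter => /andP[/hasP[a' _ /andP[? ?]] _].
  by move=> /andP[/hasP[b' _ /andP[? ?]] _]; order.
- move=> a c; rewrite !mem_filter => /andP[/hasP[a' a'F' /andP[? ?]] _].
  move=> /andP[/andP[/hasPn nb _] _]; apply/negP => ca.
  by have := nb _ a'F'; rewrite (le_trans ca) // andbT => /negP; apply.
- move=> b c; rewrite !mem_filter => /andP[/hasP[a' a'F' /andP[? ?]] _].
  move=> /andP[/andP[_ /hasPn nb] _]; apply/negP => bc.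
  by have := nb _ a'F'; rewrite (le_trans _ bc) // andbT => /negP; apply.
have cases f : f \in F -> [\/ below f /\ f < y, above f /\ y < f |
    [/\ ~~ below f, ~~ above f & incomparable y f]].
  move=> fF; have [bf|bf] := boolP (below f).
    by constructor 1; split=> //; apply: yA; rewrite mem_filter bf.
  have [af|af] := boolP (above f).
    by constructor 2; split=> //; apply: yB; rewrite mem_filter af.
  by constructor 3; split => //; apply: yC; rewrite mem_filter bf af.
exists y; split=> //.
- apply/negP => /cases[[_]|[_]|[_ _ ?]]; rewrite ?ltxx //.
  by order.
- apply/same_typeP => f fF'.
  have fx : f != x by apply: contra xF' => /eqP <-.
  have [[/hasP[a aF' /andP[? ?]] ?]|[/hasP[a aF' /andP[? ?]] ?]|[bf af yf]] :=
    cases f (F'F f fF').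
  + have ? : f < x by order.
    by rewrite (lt_gtF (x := f) (y := x)) // (lt_gtF (x := f) (y := y)) //;
      split => //; apply/idP/idP.
  + have ? : x < f by order.
    by rewrite (lt_gtF (x := x) (y := f)) // (lt_gtF (x := y) (y := f)) //;
      split => //; apply/idP/idP.
  + have [_ -> ->] := incomparable_F yf; split; apply/negP => h.
      by move/hasPn/(_ f fF'): bf; rewrite h lexx.
    by move/hasPn/(_ f fF'): af; rewrite h lexx.
- move=> g gG.
  have [[/hasP[a aF' /andP[? ?]] ?]|[_ ?]|[_ _ ?]] := cases g (GF g gG).
  + by have := GF' g a gG aF'; move=> ?; order.
  + by order.
  + by order.
Qed.

(** The new point is placed as low as its type permits: immediately above the largest member [lo] of
    [F'] below [x], before any other point of [F] in that chain, or below all points of [F] in the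
    chain when no [lo] exists. So [g <= y] would give [g <= lo]. *)
Lemma dense_chains_escape (d : Order.disp_t) (X : porderType d) (W : set X) :
  (forall x, W x -> exists y, W y /\ y < x) ->
  (forall x, W x -> exists y, W y /\ x < y) ->
  (forall x y, W x -> W y -> x < y -> exists z, [/\ W z, x < z & z < y]) ->
  (forall x y z, W x -> W y -> W z -> ~~ incomparable x y ->
     ~~ incomparable y z -> ~~ incomparable x z) ->
  escapes W.
Proof.
move=> down up dense cmp F F' G x F'F GF FW Wx xF' GF'.
have cmpl (y z : X) : y < z -> ~~ incomparable y z.
  by move=> /ltW yz; rewrite /incomparable yz.
have cmpS (y z : X) : ~~ incomparable y z -> ~~ incomparable z y.
  by rewrite incomparable_sym.
have total (y z : X) : ~~ incomparable y z -> y != z -> ~~ (y < z) -> z < y.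
  rewrite /incomparable !le_eqVlt (eq_sym z) => + yz.
  by rewrite (negbTE yz) /= negb_and !negbK => /orP[->|].
have [lowx|] := boolP (has (fun f => f < x) F'); last first.
  move/hasPn => nolow.
  have [y [Wy yx yF]] : exists y, [/\ W y, y < x &
      forall f, f \in F -> ~~ incomparable f x -> y < f].
    elim: (F) FW => [|f s IH] sW; first by have [y [? ?]] := down x Wx; exists y.
    have [|y [Wy yx ys]] := IH; first by move=> g gs; apply: sW; rewrite inE gs orbT.
    have Wf : W f by apply: sW; rewrite mem_head.
    have [fx|fx] := boolP (incomparable f x).
      exists y; split=> // g; rewrite inE => /orP[/eqP ->|/ys //].
      by rewrite fx.
    have [yf|yf] := boolP (y < f).
      by exists y; split=> // g; rewrite inE => /orP[/eqP ->|/ys].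
    have [z [Wz zf]] := down f Wf.
    have fy : f <= y.
      have [->//|ne] := eqVneq y f; apply: ltW; apply: total ne yf.
      by apply/cmpS/(cmp f x) => //; apply/cmpS/cmpl.
    exists z; split=> //; first by order.
    by move=> g; rewrite inE => /orP[/eqP -> //|/ys h /h ?]; order.
  exists y; split=> //.
  - apply/negP => yF'; have := yF _ yF' (cmpl _ _ yx); by rewrite ltxx.
  - apply/same_typeP => f fF'.
    have fx : f != x by apply: contra xF' => /eqP <-.
    have Wf := FW _ (F'F _ fF').
    have [fx'|fx'] := boolP (incomparable f x).
      have fy : incomparable f y.
        apply: contraT => h; have := cmp f y x Wf Wy Wx h (cmpl _ _ yx).
        by rewrite fx'.
      by have [_ -> ->] := incomparable_F fx'; have [_ -> ->] := incomparable_F fy.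
    have yf := yF _ (F'F _ fF') fx'.
    have xf := total _ _ fx' fx (nolow _ fF').
    by rewrite xf yf (lt_gtF xf) (lt_gtF yf).
  - move=> g gG; apply/negP => gy.
    have := yF _ (GF _ gG); rewrite /incomparable (le_trans gy (ltW yx)) /=.
    by move=> /(_ isT) ?; order.
have [lo [loF' lox loP]] : exists lo, [/\ lo \in F', lo < x &
    forall f, f \in F' -> f < x -> f <= lo].
  have [|lo [+ loP]] := @seq_maximal _ _ [seq f <- F' | f < x].
    by rewrite -has_filter.
  rewrite mem_filter => /andP[lox loF'].
  exists lo; split=> // f fF' fx.
  have [->//|ne] := eqVneq f lo.
  have Wf := FW _ (F'F _ fF'); have Wlo := FW _ (F'F _ loF').
  have /total h : ~~ incomparable lo f.
    exact: (cmp lo x f) (cmpl _ _ lox) (cmpS _ _ (cmpl _ _ fx)).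
  by apply/ltW/h; rewrite 1?eq_sym // loP // mem_filter fx fF'.
have Wlo := FW _ (F'F _ loF').
have [y [Wy loy yF]] : exists y, [/\ W y, lo < y &
      forall f, f \in F -> lo < f -> y < f].
  elim: (F) FW => [|f s IH] sW; first by have [y [? ?]] := up lo Wlo; exists y.
  have [|y [Wy loy ys]] := IH.
    by move=> g gs; apply: sW; rewrite inE gs orbT.
  have Wf : W f by apply: sW; rewrite mem_head.
  have [lof|lof] := boolP (lo < f); last first.
    exists y; split=> // g; rewrite inE => /orP[/eqP ->|/ys //].
    by rewrite (negbTE lof).
  have [yf|yf] := boolP (y < f).
    by exists y; split=> // g; rewrite inE => /orP[/eqP ->|/ys].
  have [z [Wz loz zf]] := dense lo f Wlo Wf lof.
  have fy : f <= y.
    have [->//|ne] := eqVneq y f; apply: ltW; apply: total ne yf.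
    by apply: (cmp y lo) => //; [apply/cmpS/cmpl | exact: cmpl].
  exists z; split=> //.
  by move=> g; rewrite inE => /orP[/eqP -> //|/ys h /h ?]; order.
exists y; split=> //.
- by apply/negP => yF'; have := yF _ yF' loy; rewrite ltxx.
- apply/same_typeP => f fF'.
  have fx : f != x by apply: contra xF' => /eqP <-.
  have Wf := FW _ (F'F _ fF').
  have fxy : f < x -> f < y by move=> /(loP _ fF') ?; order.
  have xfy : x < f -> y < f by move=> ?; apply: yF; [exact: F'F | order].
  have cmpf : ~~ incomparable f y -> ~~ incomparable f x.
    move=> /(cmp f y lo Wf Wy Wlo) h.
    by apply: (cmp f lo x) => //; [apply/h/cmpS/cmpl | apply: cmpl].
  split; apply/idP/idP => // h.
    have [//|nfx] := boolP (f < x).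
    by have /xfy ? := total _ _ (cmpf (cmpl _ _ h)) fx nfx; order.
  have [fx'|nfx] := boolP (f < x); first by have ? := fxy fx'; order.
  exact: total (cmpf (cmpS _ _ (cmpl _ _ h))) fx nfx.
- move=> g gG; apply/negP => gy.
  have Wg := FW _ (GF _ gG).
  have nglo := GF' g lo gG loF'.
  have log : lo < g.
    apply: total.
    + apply: (cmp g y lo) => //; last exact/cmpS/cmpl.
      by rewrite /incomparable gy.
    + by apply: contra nglo => /eqP ->.
    + by apply: contra nglo => /ltW.
  by have ? := yF _ (GF _ gG) log; order.
Qed.

(* [J] consists of the labels that may be attached to any element, [D] of those
   which force everything above the element to get a larger label. *)
Section GenericLabelling.
Context (R : realType) (d : Order.disp_t) (X : porderType d).
Context (W : set X) (J D : set R) (b : R).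
Hypothesis Xcountable : countable [set: X].
Hypothesis JDcountable : countable (J `|` D).
Hypothesis lab_gt : forall s, (J `|` D) s -> b < s.
Hypothesis right_dense : forall m t, m = b \/ D m -> m < t ->
  exists s, [/\ (J `|` D) s, m < s & s < t].
Hypothesis W0 : W !=set0.
Hypothesis Wnonalg : nonalgebraic W.
Hypothesis Wesc : D !=set0 ->
  escapes W /\ (forall x, W x -> exists y, W y /\ x < y).
Implicit Types (p q : seq (X * R)) (F G : seq X) (x y : X) (s t : R).

Let good p := (forall u, u \in p -> W u.1 /\ (J `|` D) u.2) /\
  (forall u v, u \in p -> v \in p -> (u.1 == v.1) = (u.2 == v.2) /\
     (D u.2 -> u.1 < v.1 -> u.2 < v.2)).

Let good_cons p x s : good p -> W x -> x \notin map fst p -> (J `|` D) s ->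
  s \notin map snd p -> (forall u, u \in p -> D u.2 -> u.1 < x -> u.2 < s) ->
  (D s -> forall u, u \in p -> x < u.1 -> s < u.2) -> good ((x, s) :: p).
Proof.
move=> [g1 g2] Wx xp Js sp below above; split.
  by move=> u; rewrite inE => /orP[/eqP ->|/g1].
have nx u : u \in p -> (u.1 == x) = false.
  by move=> up; apply: contraNF xp => /eqP <-; rewrite map_f.
have ns u : u \in p -> (u.2 == s) = false.
  by move=> up; apply: contraNF sp => /eqP <-; rewrite map_f.
move=> u v; rewrite !inE => /orP[/eqP ->|up] /orP[/eqP ->|vp] /=.
- by rewrite !eqxx ltxx.
- by rewrite !(eq_sym _ v.1, eq_sym _ v.2) nx // ns //; split=> // Ds; apply: above.
- by rewrite nx // ns //; split=> // Du; apply: below.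
- exact: g2.
Qed.

(** The label goes just above [m], the largest label in [D] carried by an element below [x], or [b]
    if there is none. Elements above [x] have labels beyond [m] by monotonicity, so every existing
    label greater than [m] can be left above the new one. Right density is needed only at such
    [m]. *)
Let insert p x t : good p -> W x -> x \notin map fst p -> b < t ->
  (forall u, u \in p -> D u.2 -> u.1 < x -> u.2 < t) ->
  exists s, s < t /\ good ((x, s) :: p).
Proof.
move=> gp Wx xp bt pt; have [g1 g2] := gp.
have [m [mb mP]] :=
  seq_max b [seq u.2 | u <- [seq u <- p | `[< D u.2 >] && (u.1 < x)]].
have [mbD mt mp] : [/\ m = b \/ D m, m < t & forall u, u \in p -> x < u.1 -> m < u.2].
  move: mb; rewrite inE => /orP[/eqP ->|/mapP[u +  ->]].
    by split=> //; [left | move=> u up _; apply: lab_gt; have [] := g1 u up].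
  rewrite mem_filter => /andP[/andP[/asboolP Du ux] up]; split.
  - by right.
  - exact: pt.
  - move=> v vp xv; have [_ h] := g2 u v up vp; apply: h => //.
    exact: lt_trans xv.
have [M [mM Mt MP]] := seq_lower_bound (map snd p) mt.
have [s [Js ms sM]] := right_dense mbD mM.
exists s; split; first exact: lt_le_trans Mt.
apply: good_cons => //.
- by apply/negP => /MP/(_ ms) ?; order.
- move=> u up Du ux; apply: le_lt_trans ms; apply: mP; rewrite inE.
  apply/orP; right; apply/mapP; exists u => //; rewrite mem_filter up ux.
  by rewrite !andbT; apply/asboolP.
- move=> _ u up xu; apply: lt_le_trans sM _; apply: MP; first exact: map_f.
  exact: mp.
Qed.

Let extend_dom p F : good p -> (forall f, f \in F -> W f) ->
  exists q, [/\ good q, {subset p <= q} & {subset F <= map fst q}].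
Proof.
move=> gp; elim: F => [|x F IH] FW; first by exists p; split.
have [|q [gq pq Fq]] := IH; first by move=> f fF; apply: FW; rewrite inE fF orbT.
have [xq|xq] := boolP (x \in map fst q).
  by exists q; split=> // y; rewrite inE => /orP[/eqP ->|/Fq].
have [m [_ mP]] := seq_max b (map snd q).
have [||s [_ gs]] := @insert q x (m + 1)%R gq (FW _ (mem_head _ _)) xq.
- by apply: (@le_lt_trans _ _ m); [apply: mP; rewrite mem_head | rewrite ltrDl].
- move=> u uq _ _; apply: (@le_lt_trans _ _ m); last by rewrite ltrDl.
  by apply: mP; rewrite inE map_f ?orbT.
- exists ((x, s) :: q); split=> //.
    by move=> u /pq; rewrite inE orbC => ->.
  by move=> y; rewrite inE => /orP[/eqP ->|/Fq] /=; rewrite inE ?eqxx // orbC => ->.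
Qed.

Let escape p G (F' : seq X) x : good p -> {subset F' <= map fst p} -> W x -> x \notin F' ->
  (forall g, g \in G -> exists s, D s /\ (g, s) \in p) ->
  (forall g f, g \in G -> f \in F' -> ~~ (g <= f)) ->
  exists y, [/\ W y, y \notin map fst p, same_type F' x y &
                forall g, g \in G -> ~~ (g <= y)].
Proof.
move=> [g1 _] F'p Wx xF' GD GF'.
have pW f : f \in map fst p -> W f by move=> /mapP[u /g1[? _] ->].
have [D0|/set0P/negP/negPn/eqP D0] := pselect (D !=set0).
  have [esc _] := Wesc D0; apply: esc => //.
  by move=> g /GD[s [_ gs]]; apply/mapP; exists (g, s).
have [y [Wy yp xy]] := Wnonalg F'p pW Wx xF'.
by exists y; split=> // g /GD[s []]; rewrite D0.
Qed.

(** An element for the label [s] must not lie above an element of [G], whose labels in [D] exceed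
    [s], nor, when [s] is in [D], below an element of [H], whose labels are smaller than [s]. The
    type of a point over a maximal element of [H] settles the second demand, and escaping settles
    the first. *)
Let extend_range p s : good p -> (J `|` D) s ->
  exists q, [/\ good q, {subset p <= q} & s \in map snd q].
Proof.
move=> gp Js; have [g1 g2] := gp.
have [sp|sp] := boolP (s \in map snd p); first by exists p; split.
pose G := [seq u.1 | u <- p & `[< D u.2 >] && (s < u.2)].
pose H := [seq u.1 | u <- p & (u.2 < s)].
have GD g : g \in G -> exists s, D s /\ (g, s) \in p.
  move=> /mapP[u]; rewrite mem_filter => /andP[/andP[/asboolP Du _] up] ->.
  by exists u.2; split=> //; rewrite -surjective_pairing.
suff [x [Wx xp xG xH]] : exists x, [/\ W x, x \notin map fst p,
    forall g, g \in G -> ~~ (g <= x) & D s -> forall h, h \in H -> ~~ (x < h)].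
  exists ((x, s) :: p); split; last 1 first.
  - by rewrite inE eqxx.
  - apply: good_cons => //.
      move=> u up Du ux; have us : u.2 != s.
        by apply: contra sp => /eqP <-; rewrite map_f.
      rewrite lt_neqAle us leNgt; apply/negP => su.
      have /xG : u.1 \in G.
        apply/mapP; exists u => //; rewrite mem_filter up su !andbT.
        exact/asboolP.
      by rewrite (ltW ux).
    move=> Ds u up xu; have us : s != u.2.
      by apply: contra sp => /eqP ->; rewrite map_f.
    rewrite lt_neqAle us leNgt; apply/negP => su.
    have /(xH Ds) : u.1 \in H.
      by apply/mapP; exists u => //; rewrite mem_filter up su.
    by rewrite xu.
  - by move=> u up; rewrite inE up orbT.
have [x0 Wx0] := W0.
have [[Ds H0]|nDs] := pselect (D s /\ H != [::]); last first.
  have [|||x [Wx xp _ xG]] := @escape p G [::] x0 gp _ Wx0 _ GD _ => //.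
  exists x; split=> // Ds h hH; case: nDs; split=> //.
  by case: (H) hH.
have [esc up] := Wesc (ex_intro _ s Ds).
have [h [hH hP]] := seq_maximal H0.
have Hp : {subset H <= map fst p}.
  by move=> f /mapP[u]; rewrite mem_filter => /andP[_ /(map_f fst)] + ->.
have [|x1 [Wx1 hx1]] := up h.
  by have /mapP[u /g1[+ _] ->] := Hp h hH.
have [||x [Wx xp x1x xG]] := @escape p G H x1 gp Hp Wx1 _ GD _.
- by apply/negP => /hP; rewrite hx1.
- move=> g f /mapP[u]; rewrite mem_filter => /andP[/andP[/asboolP Du su] up1] ->.
  move=> /mapP[v]; rewrite mem_filter => /andP[vs vp] ->.
  have [e mono] := g2 u v up1 vp.
  rewrite le_eqVlt e negb_or (gt_eqF (lt_trans vs su)) /=.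
  by apply/negP => /(mono Du) ?; order.
exists x; split=> // _ f fH; apply/negP => xf.
have [_ e] := same_typeP _ _ _ x1x f fH; rewrite -e in xf.
by have := hP f fH; rewrite (lt_trans hx1 xf).
Qed.

(** The first alternative makes the demand void, since [F] is then not contained in the set of
    elements labelled below [t]. *)
Let extend_type p F x t : good p -> b < t -> (forall f, f \in F -> W f) ->
  W x -> x \notin F -> exists q, [/\ good q, {subset p <= q} &
    (exists u, [/\ u \in q, u.1 \in F & t <= u.2]) \/
    (exists u, [/\ u \in q, u.2 < t, u.1 \notin F & same_type F x u.1])].
Proof.
move=> gp bt FW Wx xF.
have [q [gq pq Fq]] := extend_dom gp FW; have [g1 g2] := gq.
have [big|small] := pselect (exists u, [/\ u \in q, u.1 \in F & t <= u.2]).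
  by exists q; split=> //; left.
pose G := [seq u.1 | u <- q & `[< D u.2 >] && (t <= u.2)].
have [||y [Wy yq xy yG]] := @escape q G F x gq Fq Wx xF.
- move=> g /mapP[u]; rewrite mem_filter => /andP[/andP[/asboolP Du _] up] ->.
  by exists u.2; split=> //; rewrite -surjective_pairing.
- move=> g f /mapP[u]; rewrite mem_filter => /andP[/andP[/asboolP Du tu] uq] ->.
  move=> fF; have /mapP[v vq ef] := Fq f fF; rewrite {f}ef in fF *.
  have vt : v.2 < t by rewrite ltNge; apply/negP => tv; apply: small; exists v.
  have [e mono] := g2 u v uq vq.
  rewrite le_eqVlt e negb_or (gt_eqF (lt_le_trans vt tu)) /=.
  by apply/negP => /(mono Du) ?; order.
have [|s [st gs]] := @insert q y t gq Wy yq bt.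
  move=> u uq Du uy; rewrite ltNge; apply/negP => tu.
  have /yG : u.1 \in G.
    by apply/mapP; exists u => //; rewrite mem_filter uq tu !andbT; apply/asboolP.
  by rewrite (ltW uy).
exists ((y, s) :: q); split=> //.
  by move=> u /pq; rewrite inE orbC => ->.
right; exists (y, s); split=> //=; first exact: mem_head.
by apply: contra yq => /Fq.
Qed.

Lemma generic_labelling : exists phi : X -> R,
  [/\ forall x, W x -> (J `|` D) (phi x),
      forall x y, W x -> W y -> phi x = phi y -> x = y,
      forall s, (J `|` D) s -> exists x, W x /\ phi x = s,
      forall x y, W x -> W y -> D (phi x) -> x < y -> phi x < phi y &
      forall t F x, b < t -> (forall f, f \in F -> W f /\ phi f < t) -> W x ->
        x \notin F -> exists y, [/\ W y, phi y < t, y \notin F & same_type F x y]].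
Proof.
have [e /in2TT einj] := countable_injP _ Xcountable.
have [r rinj] := countable_injP _ JDcountable.
(* Three kinds of tasks: totality, surjectivity, and realization of types under a bound. Only
   rational bounds are used, which keeps the tasks countable. *)
pose I := ({x | W x} + {s | (J `|` D) s} + seq X * X * rat)%type.
pose code (i : I) := pickle (match i with
  | inl (inl x) => inl (inl (e (sval x)))
  | inl (inr s) => inl (inr (r (sval s)))
  | inr (F, x, q) => inr (map e F, e x, q) end).
pose task (i : I) p := match i with
  | inl (inl x) => sval x \in map fst p
  | inl (inr s) => sval s \in map snd p
  | inr (F, x, q) => b < ratr q -> (forall f, f \in F -> W f) ->
     W x -> x \notin F ->
     (exists u, [/\ u \in p, u.1 \in F & ratr q <= u.2]) \/
    (exists u, [/\ u \in p, u.2 < ratr q, u.1 \notin F & same_type F x u.1])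
  end : Prop.
have [|||G [Gfin GT]] := @generic_filter _ good I code task.
- move=> [[[x Wx]|[s Js]]|[[F x] q]] [[[x' Wx']|[s' Js']]|[[F' x'] q']];
    move=> /(pcan_inj pickleK)//= -[].
  + by move=> /einj xx'; subst x'; congr (inl (inl _)); apply: eq_exist.
  + move=> /(rinj _ _ (mem_set Js) (mem_set Js')) ss'; subst s'.
    by congr (inl (inr _)); apply: eq_exist.
  + by move=> /(inj_map einj) -> /einj -> ->.
- by split.
- move=> [[[x Wx]|[s Js]]|[[F x] q]] p gp.
  + have [|q [gq pq xq]] := @extend_dom p [:: x] gp.
      by move=> f; rewrite inE => /eqP ->.
    by exists q; split=> //=; apply: xq; rewrite mem_head.
  + by have [q [gq pq sq]] := @extend_range p s gp Js; exists q; split.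
  + have [h|h] := pselect [/\ b < ratr q, forall f, f \in F -> W f, W x & x \notin F].
      have [h1 h2 h3 h4] := h.
      have [q' [gq' pq' P]] := extend_type gp h1 h2 h3 h4.
      by exists q'; split=> //= _ _ _ _.
    by exists p; split=> // h1 h2 h3 h4; case: h.
have G2 u v : G u -> G v -> [/\ W u.1, (J `|` D) u.2,
    (u.1 == v.1) = (u.2 == v.2) & (D u.2 -> u.1 < v.1 -> u.2 < v.2)].
  move=> Gu Gv; have [|p [[g1 g2] sp _]] := Gfin [:: u; v].
    by move=> w; rewrite !inE => /orP[]/eqP ->.
  have up : u \in p by apply: sp; rewrite !inE eqxx.
  have vp : v \in p by apply: sp; rewrite !inE eqxx orbT.
  by have [? ?] := g1 u up; have [? ?] := g2 u v up vp.
have /choice[phi phiP] x : exists s, W x -> G (x, s).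
  have [Wx|] := pselect (W x); last by exists b.
  have [p [_ /mapP[[y s] xp /= exy] pG]] := GT (inl (inl (exist _ x Wx))).
  by exists s => _; apply: pG; rewrite exy.
have phiE u : G u -> phi u.1 = u.2.
  move=> Gu; have [Wu _ _ _] := G2 u u Gu Gu.
  have [_ _ h _] := G2 _ _ (phiP _ Wu) Gu.
  by apply/eqP; rewrite -h eqxx.
exists phi; split.
- by move=> x Wx; have [] := G2 _ _ (phiP x Wx) (phiP x Wx).
- move=> x y Wx Wy /eqP; have [_ _ /= <- _] := G2 _ _ (phiP x Wx) (phiP y Wy).
  by move/eqP.
- move=> s Js; have [p [_ /mapP[u up su] pG]] := GT (inl (inr (exist _ s Js))).
  have Gu := pG _ up; exists u.1; rewrite phiE //.
  by have [? _ _ _] := G2 u u Gu Gu.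
- move=> x y Wx Wy Dx xy.
  by have [_ _ _ /= h] := G2 _ _ (phiP x Wx) (phiP y Wy); apply: h.
- move=> t F x bt Ft Wx xF.
  (* The labels of the finite list [F] stay below some [m < t], so a rational bound between [m] and
     [t] can replace [t]. *)
  have [m [mb mP]] := seq_max b (map phi F).
  have mt : m < t.
    move: mb; rewrite inE => /orP[/eqP ->//|/mapP[f fF ->]].
    by have [] := Ft f fF.
  have [q /itvP qP] : exists q : rat, ratr q \in `]m, t[.
    exact: rat_in_itvoo.
  have [p [_ + pG]] := GT (inr (F, x, q)).
  have bq : b < ratr q.
    by apply: (@le_lt_trans _ _ m); rewrite ?qP // mP // mem_head.
  case=> // [f fF|[u [up uF qu]]|[u [up uq uF xu]]].
  + by have [] := Ft f fF.
  + have := mP u.2; rewrite inE -phiE ?map_f ?orbT //; last exact: pG.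
    move=> /(_ isT) h; have := le_lt_trans h (_ : m < ratr q).
    rewrite qP => /(_ isT); rewrite phiE; last exact: pG.
    by rewrite ltNge qu.
  + have Gu := pG _ up; exists u.1; rewrite phiE //; split=> //.
      by have [] := G2 u u Gu Gu.
    by apply: lt_trans uq _; rewrite qP.
Qed.

End GenericLabelling.

(** * Labellings of homogeneous posets *)

Lemma infinite_fresh (T : eqType) (A : set T) (F : seq T) : infinite_set A ->
  exists x, A x /\ x \notin F.
Proof.
move=> infA; apply: contrapT => no; apply: infA.
apply: (@sub_finite_set _ _ [set` F]); last exact: finite_seq.
by move=> x Ax /=; apply: contrapT => /negP xF; apply: no; exists x.
Qed.

Lemma injective_fresh (T : eqType) (u : nat -> T) (F : seq T) :
  injective u -> exists k, u k \notin F.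
Proof.
move=> uinj; apply: contrapT => no.
have : (size (map u (iota 0 (size F).+1)) <= size F)%N.
  apply: uniq_leq_size; first by rewrite map_inj_uniq // iota_uniq.
  move=> _ /mapP[k _ ->]; apply: contrapT => /negP kF.
  by apply: no; exists k.
by rewrite size_map size_iota ltnn.
Qed.

Lemma countable_setU (T : Type) (A B : set T) :
  countable A -> countable B -> countable (A `|` B).
Proof.
move=> cA cB; rewrite -bigcup2E; apply: bigcup_countable => //.
by move=> [|[|n]] _ /=.
Qed.

Lemma countable_subset (T : Type) (A B : set T) :
  A `<=` B -> countable B -> countable A.
Proof. by move=> AB; apply: sub_countable; apply: subset_card_le. Qed.

(** The last clause carries maximality. At a label of [J] the upper set is allowed because it also
    belongs to the chain, being the member indexed by the right end of the gap. *)
Definition labelling (R : realType) (d : Order.disp_t) (X : porderType d)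
    (J D : set R) (b : R) (phi : X -> R) : Prop :=
  [/\ forall x, (J `|` D) (phi x),
      forall s, (J `|` D) s -> exists x, phi x = s,
      forall t, b < t -> copies X [set x | phi x < t] &
      forall s A, copies X A -> [set x | phi x < s] `<=` A ->
        A `<=` [set x | phi x <= s] ->
        A = [set x | phi x < s] \/ J s /\ A = [set x | phi x <= s]].

Section Labelling.
Context (R : realType) (d : Order.disp_t) (X : porderType d).
Context (J D : set R) (b : R).
Hypothesis Xcountable : countable [set: X].
Hypothesis Xinfinite : infinite_set [set: X].
Hypothesis hom : homogeneous X.
Hypothesis JDcountable : countable (J `|` D).
Hypothesis JD : forall s, J s -> ~ D s.
Hypothesis lab_gt : forall s, (J `|` D) s -> b < s.
Hypothesis right_dense_b : forall t, b < t ->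
  exists s, [/\ (J `|` D) s, b < s & s < t].
Hypothesis right_dense_D : forall m t, D m -> m < t ->
  exists s, [/\ D s, m < s & s < t].
Hypothesis nonanti : D !=set0 -> exists x y : X, x < y.
Implicit Types (x y z : X) (F : seq X).

Let right_dense m t : m = b \/ D m -> m < t ->
  exists s, [/\ (J `|` D) s, m < s & s < t].
Proof.
move=> [->|Dm] mt; first exact: right_dense_b.
by have [s [Ds ms st]] := right_dense_D Dm mt; exists s; split => //; right.
Qed.

Lemma labelling_of_types (phi : X -> R) : (forall x, (J `|` D) (phi x)) ->
  (forall s, (J `|` D) s -> exists x, phi x = s) ->
  (forall x y, D (phi x) -> x < y -> phi x < phi y) ->
  (forall t, b < t -> realizes_types [set x | phi x < t]) ->
  (forall A x y, copies X A -> A x -> J (phi x) -> phi y = phi x ->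
     A `<=` [set z | phi z <= phi x] -> A y) ->
  labelling J D b phi.
Proof.
move=> lab onto mono types fibre; split=> // [t bt|s A cA sA As].
  by apply: realizes_types_copy => //; apply: types.
have [[x [Ax xs]]|no] := pselect (exists x, A x /\ phi x = s); last first.
  left; apply/seteqP; split=> // x Ax /=; rewrite lt_neqAle (As x Ax) andbT.
  by apply/eqP => xs; apply: no; exists x.
right; have := lab x; rewrite xs => -[Js|Ds].
  split=> //; apply/seteqP; split=> // y /=; rewrite le_eqVlt => /orP[/eqP ys|].
    by apply: (fibre A x) => //; rewrite ?xs.
  exact: sA.
exfalso.
have [y xy] : exists y, x < y.
  by apply: homogeneous_up => //; apply: nonanti; exists s.
have rA := copy_realizes_types hom cA.
have [||z [Az _ yz]] := rA [:: x] y.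
- by move=> f; rewrite inE => /eqP ->.
- by rewrite inE gt_eqF.
have [xz _] := same_typeP _ _ _ yz x (mem_head x [::]).
have := As z Az; rewrite /= leNgt => /negP; apply; rewrite -xs.
by apply: mono; rewrite ?xs // -xz.
Qed.

Lemma injective_labelling : nonalgebraic [set: X] ->
  (D !=set0 -> escapes [set: X]) -> exists phi : X -> R, labelling J D b phi.
Proof.
move=> nonalg esc.
have [|||phi [lab inj onto mono types]] := @generic_labelling R _ X [set: X] J D b
  Xcountable JDcountable lab_gt right_dense.
- exact: infinite_setN0.
- by [].
- move=> D0; split; first exact: esc.
  by move=> x _; have [y xy] := homogeneous_up hom (nonanti D0) x; exists y.
exists phi; apply: labelling_of_types.
- by move=> x; apply: lab.
- by move=> s /onto[x [_ xs]]; exists x.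
- by move=> x y; apply: mono.
- move=> t bt F x Ft xF; have [|||y [_ yt yF xy]] := types t F x bt => //.
    by move=> f /Ft.
  by exists y.
- by move=> A x y _ Ax _ /inj ->.
Qed.

(** * Posets with transitive incomparability *)

Definition level x y := (x == y) || incomparable x y.

Section Levels.
Hypothesis level_trans : forall x y z, level x y -> level y z -> level x z.
Hypothesis Xlt : exists x y : X, x < y.

Lemma level_refl x : level x x. Proof. by rewrite /level eqxx. Qed.

Lemma level_sym x y : level x y = level y x.
Proof. by rewrite /level eq_sym incomparable_sym. Qed.

Lemma levelP x y : reflect (~ (x < y) /\ ~ (y < x)) (level x y).
Proof.
rewrite /level /incomparable !le_eqVlt (eq_sym y).
by have [<-|_] := eqVneq x y; rewrite ?ltxx /=; apply: (iffP idP) => //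
  [/andP[/negP ? /negP]//|[/negP -> /negP ->]].
Qed.

Lemma not_level x y : ~~ level x y -> (x < y) || (y < x).
Proof.
by apply: contraR; rewrite negb_or => /andP[/negP ? /negP ?]; apply/levelP.
Qed.

Lemma level_lt x x' y y' : level x x' -> level y y' -> (x < y) = (x' < y').
Proof.
suff main u u' v v' : level u u' -> level v v' -> u < v -> u' < v'.
  by move=> xx yy; apply/idP/idP; apply: main; rewrite // level_sym.
move=> uu vv uv.
have uv' : u < v'.
  have [uv'|/not_level/orP[//|v'u]] := boolP (level u v').
    by rewrite level_sym in vv; have /levelP[] := level_trans uv' vv.
  by have := lt_trans v'u uv; have /levelP[_] := vv.
have [h|/not_level/orP[//|v'u']] := boolP (level u' v').
  by have /levelP[] := level_trans uu h.
by have := lt_trans uv' v'u'; have /levelP[] := uu.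
Qed.

Definition rep x := choose (level x) x.

Lemma level_rep x : level x (rep x).
Proof. by apply: chooseP; apply: level_refl. Qed.

Lemma level_rep_eq x y : level x y -> rep x = rep y.
Proof.
move=> xy; rewrite /rep; have e : level x =1 level y.
  move=> z; apply/idP/idP; apply: level_trans => //; by rewrite level_sym.
by rewrite (eq_choose e); apply: choose_id; rewrite ?level_refl // level_sym.
Qed.

Lemma rep_eqP x y : reflect (rep x = rep y) (level x y).
Proof.
apply: (iffP idP); first exact: level_rep_eq.
move=> e; apply: level_trans (level_rep x) _; rewrite e level_sym.
exact: level_rep.
Qed.

Lemma rep_rep x : rep (rep x) = rep x.
Proof. by apply: level_rep_eq; rewrite level_sym level_rep. Qed.

Lemma rep_lt x y : (rep x < rep y) = (x < y).
Proof. by apply: level_lt; rewrite level_sym level_rep. Qed.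

Let W : set X := [set x | rep x = x].

Let Wrep x : W (rep x). Proof. exact: rep_rep. Qed.

Let W_lt x y : W x -> W y -> x != y -> (x < y) || (y < x).
Proof.
move=> Wx Wy; apply: contraR => h; apply/eqP; rewrite -Wx -Wy.
by apply: level_rep_eq; apply: contraR h; apply: not_level.
Qed.

Let W_escapes : escapes W.
Proof.
apply: dense_chains_escape.
- move=> x Wx; have [y yx] := homogeneous_down hom Xlt x.
  by exists (rep y); split=> //; rewrite -Wx rep_lt.
- move=> x Wx; have [y yx] := homogeneous_up hom Xlt x.
  by exists (rep y); split=> //; rewrite -Wx rep_lt.
- move=> x y Wx Wy /(homogeneous_dense hom Xlt)[z [xz zy]].
  by exists (rep z); split; rewrite // -1?Wx -1?Wy rep_lt.
- move=> x y z Wx _ Wz _ _; apply/negP => xz.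
  have [e1 e2 e3] := incomparable_F xz.
  by have := W_lt Wx Wz; rewrite e1 e2 e3 => /(_ isT).
Qed.

Let W_up x : W x -> exists y, W y /\ x < y.
Proof.
move=> Wx; have [y xy] := homogeneous_up hom Xlt x.
by exists (rep y); split=> //; rewrite -Wx rep_lt.
Qed.

Let W0 : W !=set0.
Proof. by have [x _] := Xlt; exists (rep x). Qed.

Let Wnonalg := escapes_nonalgebraic W_escapes.

Let same_type_rep F x y :
  same_type (map rep F) (rep x) (rep y) -> same_type F x y.
Proof.
move=> /same_typeP xy; apply/same_typeP => f fF.
by have := xy _ (map_f rep fF); rewrite !rep_lt.
Qed.

Let level_same_type F x y : level x y -> same_type F x y.
Proof.
move=> xy; apply/same_typeP => f _.
by split; apply: level_lt; rewrite // level_refl.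
Qed.

(** Whole levels share a label. A copy that meets a finite level contains it: if [y] were missing,
    its type over the present part of the level would demand one more point of that level in the
    copy. *)
Lemma finite_levels_labelling :
  (forall x, exists F, forall y, level x y -> y \in F) ->
  exists phi : X -> R, labelling J D b phi.
Proof.
move=> fin.
have [|phi [lab inj onto mono types]] := @generic_labelling R _ X W J D b
  Xcountable JDcountable lab_gt right_dense W0 Wnonalg.
  by move=> _; split.
exists (phi \o rep); apply: labelling_of_types => /=.
- by move=> x; apply: lab.
- by move=> s /onto[x [Wx xs]]; exists x; rewrite Wx.
- by move=> x y Dx xy; apply: mono; rewrite ?rep_lt.
- move=> t bt F x Ft xF.
  have [/hasP[f fF fx]|/hasPn nF] := boolP (has (level x) F).
    exists x; split=> //; last exact: same_type_refl.
    by rewrite /= (level_rep_eq fx); apply: Ft.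
  have [||y [Wy yt yF xy]] := types t (map rep F) (rep x) bt _ (Wrep x).
  + by move=> f /mapP[g gF ->]; split=> //; apply: Ft.
  + by apply/mapP => -[g gF /rep_eqP]; apply/negP/nF.
  exists y; split; rewrite /= ?Wy //.
    by apply: contra yF => /(map_f rep); rewrite Wy.
  by apply: same_type_rep; rewrite Wy.
- move=> A x y cA Ax Jx yx Aphi.
  have xy : level x y by apply/rep_eqP/esym/inj.
  apply: contrapT => nAy; have [Fx FxP] := fin x.
  pose F := [seq f <- Fx | `[< A f >]].
  have rA := copy_realizes_types hom cA; have [||z [Az zF yz]] := rA F y.
  + by move=> f; rewrite mem_filter => /andP[/asboolP].
  + by rewrite mem_filter; apply/negP => /andP[/asboolP].
  have xF : x \in F.
    by rewrite mem_filter FxP ?level_refl // andbT; apply/asboolP.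
  case/negP: zF; rewrite mem_filter; apply/andP; split; first exact/asboolP.
  apply: FxP; apply/levelP; have [<- <-] := same_typeP _ _ _ yz x xF.
  exact/levelP.
Qed.

(** Homogeneity carries [(size F).+1] distinct points of the level of [x1] into the level of [x],
    and one of them escapes [F]. *)
Lemma infinite_level_transfer x1 x F :
  (forall F, exists y, level x1 y /\ y \notin F) ->
  exists y, level x y /\ y \notin F.
Proof.
move=> inf.
have levelE (u v u' v' : X) : (u == v) = (u' == v') -> (u < v) = (u' < v') ->
    (v < u) = (v' < u') -> level u v = level u' v'.
  move=> e1 e2 e3; apply/levelP/levelP; by rewrite e2 e3.
have [p [pp px up sp]] : exists p : seq (X * X), [/\ piso p, (x1, x) \in p,
    uniq (map snd p) & size p = (size F).+1 /\
    forall u, u \in p -> level x u.2].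
  elim: (size F) => [|n [p [pp px up [sp pl]]]].
    exists [:: (x1, x)]; split=> //; first by rewrite /piso /= !eqxx !ltxx.
      exact: mem_head.
    by split=> // u; rewrite inE => /eqP ->; apply: level_refl.
  have [y [x1y yp]] := inf (map fst p).
  have [z pz] := hom pp y; have [_ zP] := piso_consP pz.
  exists ((y, z) :: p); split=> //; first by rewrite inE px orbT.
    rewrite /= up andbT; apply: contra yp => /mapP[u up' zu].
    have [+ _ _] := zP u up'; rewrite zu eqxx => /eqP <-; exact: map_f.
  split; first by rewrite /= sp.
  move=> u; rewrite inE => /orP[/eqP ->|/pl //].
  have [/= e1 e2 e3] := zP _ px.
  by rewrite -(levelE x1 y x z).
have [y yp yF] : exists2 y, y \in map snd p & y \notin F.
  apply: contrapT => no.
  have : (size (map snd p) <= size F)%N.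
    apply: uniq_leq_size => // y yp; apply: contrapT => /negP yF.
    by apply: no; exists y.
  by rewrite size_map sp.1 ltnn.
by exists y; split=> //; have /mapP[u /sp.2 + ->] := yp.
Qed.

Hypothesis infinite_level : forall x F, exists y, level x y /\ y \notin F.

Let split_J_labelling (theta phi : X -> R) :
  (forall x, (J `|` D) (phi x)) -> (forall s, (J `|` D) s -> exists x, phi x = s) ->
  (forall x y, D (phi x) -> x < y -> phi x < phi y) ->
  (forall t, b < t -> realizes_types [set x | phi x < t]) ->
  (forall x y, J (phi x) -> phi y = phi x -> x = y) ->
  labelling J D b phi.
Proof.
move=> lab onto mono types inj; apply: labelling_of_types => //.
by move=> A x y _ Ax Jx /inj <-.
Qed.

(** Levels labelled in [D] keep one label each. To use the labels of [J] once each, an initial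
    segment of levels is split into points and labelled afresh with [D] empty. That labelling
    requires right density at [b] only, which is the hypothesis on [J]; nonalgebraicity holds there
    because levels are infinite. *)
Lemma infinite_levels_labelling_near :
  (forall t, b < t -> exists s, [/\ J s, b < s & s < t]) ->
  exists phi : X -> R, labelling J D b phi.
Proof.
move=> Jnear.
(* Dummy labels just below [b]. The levels that receive them form [low], lie under all other levels,
   and get their final labels from [J]. *)
pose E : set R := [set s | exists q : rat, s = ratr q /\ (b - 1)%R < s < b].
have Ecount : countable E.
  apply: (@countable_subset _ _ (range (@ratr R))).
    by move=> s [q [-> _]]; exists q.
  by apply: sub_countable (card_image_le _ _) _; exact: countableP.
have ED_count : countable (set0 `|` (E `|` D)).
  rewrite set0U; apply: countable_setU => //.
  exact: countable_subset JDcountable.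
have Edense m t : (b - 1)%R <= m -> m < t -> m < b -> exists s, [/\ E s, m < s & s < t].
  move=> bm mt mb; have [|q] := @rat_in_itvoo R m (Order.min t b) _.
    by rewrite lt_min mt mb.
  rewrite in_itv /= lt_min => /and3P[mq qt qb]; exists (ratr q); split=> //.
  by exists q; rewrite qb (le_lt_trans bm mq).
have b1 : (b - 1)%R < b by rewrite ltrBlDr ltrDl.
have [|||theta [lab inj onto mono types]] := @generic_labelling R _ X W set0
   (E `|` D) (b - 1)%R Xcountable ED_count _ _ W0 Wnonalg.
- move=> s [//|[[q [_ /andP[]]] //|Ds]].
  by apply: lt_trans b1 _; apply: lab_gt; right.
- move=> m t [->|[[q [_ /andP[bm mb]]]|Dm]] mt.
  + by have [s [? ? ?]] := Edense _ _ (lexx _) mt b1; exists s; split=> //; right; left.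
  + by have [s [? ? ?]] := Edense _ _ (ltW bm) mt mb; exists s; split=> //; right; left.
  + by have [s [? ? ?]] := right_dense_D Dm mt; exists s; split=> //; right; right.
- by move=> _; split.
pose low : set X := [set x | theta (rep x) < b].
have theta_case x : (theta (rep x) < b) \/ b < theta (rep x) /\ D (theta (rep x)).
  have [//|[[q [_ /andP[_ ?]]]|Dx]] := lab (rep x) (Wrep x); first by left.
  by right; split=> //; apply: lab_gt; right.
have low_level x y : level x y -> low x -> low y.
  by rewrite /low /= => /level_rep_eq ->.
have theta_lt x y : b < theta (rep x) -> x < y -> theta (rep x) < theta (rep y).
  move=> bx xy; apply: mono; rewrite ?rep_lt //.
  have [xb|[_ Dx]] := theta_case x; last by right.
  by have := lt_trans bx xb; rewrite ltxx.
have J0count : countable (J `|` set0).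
  by rewrite setU0; apply: countable_subset JDcountable.
have [|||||lambda [llab linj lonto _ ltypes]] := @generic_labelling R _ X low J
   set0 b Xcountable J0count.
- by move=> s [Js|//]; apply: lab_gt; left.
- move=> m t [->|//] bt; have [s [Js bs st]] := Jnear t bt.
  by exists s; split=> //; left.
- have [s [Es _ sb]] := Edense (b - 1)%R b (lexx _) b1 b1.
  have [|x [Wx xs]] := onto s; first by right; left.
  by exists x; rewrite /low /= Wx xs.
- move=> F F' x F'F Flow lx xF'.
  have [y [xy yF]] := infinite_level x F.
  exists y; split=> //; first exact: low_level lx.
  exact: level_same_type.
- by move=> [].
pose phi x := if theta (rep x) < b then lambda x else theta (rep x).
have phi_low x : low x -> phi x = lambda x /\ J (phi x).
  by move=> lx; rewrite /phi lx; split=> //; have [] := llab x lx.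
have phi_high x : ~~ (theta (rep x) < b) -> [/\ phi x = theta (rep x),
    b < theta (rep x) & D (phi x)].
  move=> hx; rewrite /phi (negbTE hx).
  by have [lx|[]] := theta_case x; first by rewrite lx in hx.
exists phi; apply: (@split_J_labelling (theta \o rep)).
- move=> x; have [/phi_low[_]|/phi_high[_ _]] := boolP (theta (rep x) < b).
    by left.
  by right.
- move=> s [Js|Ds].
    have [|x [lx xs]] := lonto s; first by left.
    by exists x; have [-> _] := phi_low x lx.
  have [|x [Wx xs]] := onto s; first by right; right.
  exists x; rewrite /phi Wx xs.
  by rewrite ltNge ltW // lab_gt //; right.
- move=> x y Dx xy.
  have [/phi_low[_ Jx]|hx] := boolP (theta (rep x) < b); first by case: (JD Jx).
  have [-> bx _] := phi_high x hx.
  have ty := theta_lt x y bx xy.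
  have hy : ~~ (theta (rep y) < b) by rewrite -leNgt (ltW (lt_trans bx ty)).
  by have [-> _ _] := phi_high y hy.
- move=> t bt F x Ft xF.
  pose F1 := [seq f <- F | theta (rep f) < b].
  have F1t f : f \in F1 -> low f /\ lambda f < t.
    rewrite mem_filter => /andP[lf /Ft]; rewrite /= /phi lf.
    by split.
  (* a low element with a prescribed type over [F1] exists with small label,
     and the elements of [F] outside [F1] lie above all low elements *)
  have find y : low y -> y \notin F1 ->
      exists z, [/\ phi z < t, z \notin F & same_type F y z].
    move=> ly yF1; have [z [lz zt zF1 /same_typeP yz]] := ltypes t F1 y bt F1t ly yF1.
    exists z; split.
    + by have [-> _] := phi_low z lz.
    + by move: zF1; rewrite mem_filter; rewrite /low /= in lz; rewrite lz.
    + apply/same_typeP => f fF.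
      have [lf|hf] := boolP (theta (rep f) < b).
        by apply: yz; rewrite mem_filter lf.
      have [_ bf _] := phi_high f hf.
      have up w : low w -> (w < f) && ~~ (f < w).
        move=> lw; have nfw : ~~ (f < w).
          apply/negP => /(theta_lt _ _ bf) fw.
          by have := lt_trans (lt_trans bf fw) lw; rewrite ltxx.
        rewrite nfw andbT.
        have [/rep_eqP e|/not_level/orP[//|fw]] := boolP (level w f).
          by have := lt_trans bf (_ : theta (rep f) < b); rewrite -e ltxx => /(_ lw).
        by rewrite fw in nfw.
      have /andP[-> /negbTE ->] := up y ly.
      by have /andP[-> /negbTE ->] := up z lz.
  have theta_le f : f \in F -> theta (rep f) < t.
    move=> /Ft /=; rewrite /phi.
    by have [lf _|] := boolP (theta (rep f) < b); first exact: lt_trans bt.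
  have [/hasP[f fF fx]|/hasPn nF] := boolP (has (level x) F).
    have [lx|hx] := boolP (theta (rep x) < b).
      apply: find => //; rewrite mem_filter; by apply/nandP; right.
    exists x; split=> //; last exact: same_type_refl.
    have [e _ _] := phi_high x hx.
    by rewrite /= e (level_rep_eq fx) theta_le.
  have [||y [Wy yt yF xy]] :=
    types t (map rep F) (rep x) (lt_trans b1 bt) _ (Wrep x).
  + by move=> f /mapP[g gF ->]; split=> //; apply: theta_le.
  + by apply/mapP => -[g gF /rep_eqP]; apply/negP/nF.
  have {}xy : same_type F x y by apply: same_type_rep; rewrite Wy.
  have {}yF : y \notin F by apply: contra yF => /(map_f rep); rewrite Wy.
  have [ly|hy] := boolP (theta (rep y) < b).
    have [|z [zt zF yz]] := find y ly; first by rewrite mem_filter (negbTE yF) andbF.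
    by exists z; split=> //; apply: same_type_trans yz.
  exists y; split=> //; have [e _ _] := phi_high y hy.
  by rewrite /= e Wy.
- move=> x y Jx yx.
  have lw z : phi z = phi x -> low z.
    move=> zx; apply: contrapT => /negP /phi_high[_ _].
    by rewrite zx; apply: JD.
  apply: linj; rewrite /low /=; [exact: lw | exact: lw |].
  have [<- _] := phi_low x (lw x erefl).
  by have [<- _] := phi_low y (lw y yx).
Qed.

(** Here [D] accumulates at [b]. All levels are labelled in [D], and then points of a single level
    with label below [eps] are raised to labels in [J]. Raising does not disturb monotonicity,
    because elements labelled in [D] are never raised; types survive because infinitely many points
    of the level keep their label. *)
Lemma infinite_levels_labelling_far (eps : R) :
  b < eps -> (forall s, J s -> eps <= s) ->
  exists phi : X -> R, labelling J D b phi.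
Proof.
move=> beps Jfar.
have D_count : countable (set0 `|` D).
  by rewrite set0U; apply: countable_subset JDcountable.
have D_near t : b < t -> exists s, [/\ D s, b < s & s < t].
  move=> bt; have [|s [Js bs]] := @right_dense_b (Order.min t eps).
    by rewrite lt_min bt.
  rewrite lt_min => /andP[st se]; exists s; split=> //.
  by case: Js => // /Jfar; rewrite leNgt se.
have [|||theta [lab inj onto mono types]] := @generic_labelling R _ X W set0
   D b Xcountable D_count _ _ W0 Wnonalg.
- by move=> s [//|Ds]; apply: lab_gt; right.
- move=> m t [->|Dm] mt.
    by have [s [? ? ?]] := D_near _ mt; exists s; split=> //; right.
  by have [s [? ? ?]] := right_dense_D Dm mt; exists s; split=> //; right.
- by move=> _; split.
have {}lab x : D (theta (rep x)) by have [] := lab (rep x) (Wrep x).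
have [s0 [Ds0 _ s0eps]] := D_near eps beps.
have [|c [Wc cs0]] := onto s0; first by right.
have level_c x : level c x -> theta (rep x) = s0.
  by move=> /level_rep_eq <-; rewrite Wc.
have inf_c : infinite_set [set x | level c x].
  move=> /finite_seqP[F FE].
  by have [y [cy /negP]] := infinite_level c F; apply; have : [set` F] y by rewrite -FE.
have /infiniteP/card_leP[u0] := inf_c.
pose u k := val (u0 (to_setT k)).
have [r rinj] := countable_injP _ JDcountable.
have uc k : level c (u k) by exact: (set_valP (u0 (to_setT k))).
have uinj : injective u.
  move=> k l /val_inj kl.
  have := @functions.inj _ _ _ u0 (to_setT k) (to_setT l); rewrite !in_setT.
  by move=> /(_ isT isT kl) /(congr1 val).
(* Only points with even index are raised; those with odd index keep the label [s0] and provide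
   fresh realizations. *)
pose jump s := u (r s).*2.
have jump_inj s s' : J s -> J s' -> jump s = jump s' -> s = s'.
  move=> Js Js' /uinj/double_inj; apply: rinj; rewrite inE; by left.
have /choice[phi phiP] x : exists t, (exists s, [/\ J s, jump s = x & t = s]) \/
    (~ exists s, J s /\ jump s = x) /\ t = theta (rep x).
  have [[s [Js sx]]|no] := pselect (exists s, J s /\ jump s = x).
    by exists s; left; exists s.
  by exists (theta (rep x)); right.
have theta_le x : theta (rep x) <= phi x.
  have [[s [Js sx ->]]|[_ -> //]] := phiP x.
  by rewrite level_c -?sx ?uc // (le_trans (ltW s0eps)) // Jfar.
have phiD x : D (phi x) -> phi x = theta (rep x).
  by have [[s [Js _ ->]]|[_ //]] := phiP x; move/(JD Js).
have fresh x F : exists y, [/\ level x y, y \notin F & phi y = theta (rep x)].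
  have [cx|cx] := boolP (level c x); last first.
    have [y [xy yF]] := infinite_level x F; exists y; split=> //.
    have [[s [Js sy _]]|[_ ->]] := phiP y; last by rewrite (level_rep_eq xy).
    case/negP: cx; apply: (@level_trans _ y); first by rewrite -sy uc.
    by rewrite level_sym.
  have [k yF] : exists k, u k.*2.+1 \notin F.
    by apply: (@injective_fresh _ (fun k => u k.*2.+1)) => k l /uinj[] /double_inj.
  have cy := uc k.*2.+1.
  exists (u k.*2.+1); split=> //; first by apply: level_trans cy; rewrite level_sym.
  have [[s [Js /uinj e _]]|[_ ->]] := phiP (u k.*2.+1); last by rewrite !level_c.
  by have := congr1 odd e; rewrite /= !odd_double.
exists phi; apply: (@split_J_labelling (theta \o rep)).
- move=> x; have [[s [Js _ ->]]|[_ ->]] := phiP x; [by left | by right].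
- move=> s [Js|Ds].
    exists (jump s); have [[s' [Js' e ->]]|[[]]] := phiP (jump s); last by exists s.
    exact: jump_inj e.
  have [|x [Wx xs]] := onto s; first by right.
  by have [y [_ _ ys]] := fresh x [::]; exists y; rewrite ys Wx.
- move=> x y Dx xy; rewrite phiD //; apply: lt_le_trans (theta_le y).
  by apply: mono; rewrite ?rep_lt.
- move=> t bt F x Ft xF.
  have Ft' f : f \in F -> theta (rep f) < t.
    by move=> /Ft; apply: le_lt_trans.
  have [/hasP[f fF fx]|/hasPn nF] := boolP (has (level x) F).
    have [y [xy yF ys]] := fresh x F; exists y; split=> //.
      by rewrite /= ys (level_rep_eq fx) Ft'.
    exact: level_same_type.
  have [||y [Wy yt yF xy]] := types t (map rep F) (rep x) bt _ (Wrep x).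
  + by move=> f /mapP[g gF ->]; split=> //; apply: Ft'.
  + by apply/mapP => -[g gF /rep_eqP]; apply/negP/nF.
  have [z [yz zF zs]] := fresh y F; exists z; split=> //.
    by rewrite /= zs Wy.
  apply: (same_type_trans _ (level_same_type _ yz)).
  by apply: same_type_rep; rewrite Wy.
- move=> x y Jx yx; have [[s [Js sx es]]|[_ ex]] := phiP x; last first.
    by case: (JD Jx); rewrite ex.
  have [[s' [Js' sy es']]|[_ ey]] := phiP y; last first.
    by case: (JD Jx); rewrite -yx ey.
  by rewrite -sx -sy; congr jump; rewrite -es -es' yx.
Qed.

End Levels.

Lemma labelling_exists : exists phi : X -> R, labelling J D b phi.
Proof.
have [[x0 [y0 xy0]]|anti] := pselect (exists x y : X, x < y); last first.
  apply: injective_labelling => [F F' x _ _ _ _|/nonanti //].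
  have [y [_ yF]] := infinite_fresh F Xinfinite.
  exists y; split=> //; apply/same_typeP => f _.
  by split; apply/idP/idP => h; case: anti; [exists f, x| exists f, y|
    exists x, f| exists y, f].
have Xlt : exists x y : X, x < y by exists x0, y0.
have easy : escapes [set: X] -> exists phi : X -> R, labelling J D b phi.
  by move=> esc; apply: injective_labelling => //; apply: escapes_nonalgebraic.
have [cmp|level_trans|/extension_property_escapes //] := homogeneous_trichotomy hom.
  apply: easy; apply: dense_chains_escape.
  - by move=> x _; have [y ?] := homogeneous_down hom Xlt x; exists y.
  - by move=> x _; have [y ?] := homogeneous_up hom Xlt x; exists y.
  - by move=> x y _ _ /(homogeneous_dense hom Xlt)[z []]; exists z.
  - by move=> x y z _ _ _; apply: cmp.
have [fin|nfin] := pselect (forall x, exists F, forall y, level x y -> y \in F).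
  exact: finite_levels_labelling.
have inf x F : exists y, level x y /\ y \notin F.
  have [x1 x1P] : exists x1, forall F, exists y, level x1 y /\ y \notin F.
    apply: contrapT => no; apply: nfin => x1; apply: contrapT => no1.
    apply: no; exists x1 => G; apply: contrapT => no2; apply: no1; exists G.
    by move=> y x1y; apply: contrapT => /negP yG; apply: no2; exists y.
  exact: infinite_level_transfer.
have [near|far] := pselect (forall t, b < t -> exists s, [/\ J s, b < s & s < t]).
  exact: infinite_levels_labelling_near.
have [eps beps epsP] : exists2 eps, b < eps & forall s, J s -> eps <= s.
  apply: contrapT => no; apply: far => t bt; apply: contrapT => no1; apply: no.
  exists t => // s Js; rewrite leNgt; apply/negP => st; apply: no1.
  by exists s; split=> //; apply: lab_gt; left.
exact: (@infinite_levels_labelling_far level_trans Xlt inf eps).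
Qed.

End Labelling.

(** * From compact sets to maximal chains *)

Lemma rat_between (R : realType) (x y : R) :
  x < y -> exists q : rat, x < ratr q /\ ratr q < y.
Proof.
by move=> /rat_in_itvoo[q]; rewrite in_itv /= => /andP[? ?]; exists q.
Qed.

Section CompactLabels.
Context (R : realType) (K : set R) (m : R).
Implicit Types a s t x y : R.

Definition gap_left : set R := [set a | K a /\ exists c, [/\ K c, a < c &
  forall y, a < y -> y < c -> ~ K y]].

Definition inner_rational : set R := [set s | exists q : rat, s = ratr q /\
  exists a c, [/\ a < s, s < c & forall y, a < y -> y < c -> K y]].

Hypothesis Kcompact : compact K.
Hypothesis Km : K m.
Hypothesis m_lb : lbound K m.
Hypothesis m_limit : limit_point K m.

Let J := gap_left.
Let D := inner_rational.

Lemma compact_has_ubound : has_ubound K.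
Proof.
have [M [_ MP]] := compact_bounded Kcompact.
exists (M + 1)%R => x Kx; apply: le_trans (ler_norm x) _.
by apply: (MP (M + 1)%R) => //; rewrite ltrDl.
Qed.

Lemma compact_sup_mem (A : set R) : A `<=` K -> A !=set0 -> K (sup A).
Proof.
move=> AK A0; have [M MP] := compact_has_ubound.
have cl : closed K by apply: compact_closed Kcompact; exact: Rhausdorff.
apply: cl; apply: (closureS AK); apply: closure_sup => //.
by exists M => x /AK; apply: MP.
Qed.

Lemma compact_inf_mem (A : set R) : A `<=` K -> A !=set0 -> K (inf A).
Proof.
move=> AK A0.
have cl : closed K by apply: compact_closed Kcompact; exact: Rhausdorff.
apply: cl; apply: (closureS AK) => B /nbhs_ballP[e /= e0 eB].
have hA : has_inf A by split=> //; exists m => x /AK; apply: m_lb.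
have [y Ay ye] := inf_adherent e0 hA.
exists y; split=> //; apply: eB; rewrite /ball /= distrC ger0_norm.
  by rewrite ltrBlDl.
by rewrite subr_ge0; apply: ge_inf Ay; case: hA.
Qed.

Lemma limit_near t : m < t -> exists x, [/\ K x, m < x & x < t].
Proof.
move=> mt; have : nbhs m [set x | x < t] by exact: lt_nbhsl.
move=> /m_limit[x [xm Kx xt]]; exists x; split=> //.
by rewrite lt_neqAle eq_sym xm m_lb.
Qed.

Lemma label_mem s : (J `|` D) s -> K s.
Proof. by move=> [[]//|[q [-> [a [c [? ? h]]]]]]; apply: h. Qed.

Lemma label_gt s : (J `|` D) s -> m < s.
Proof.
move=> [[Ks [c [Kc sc h]]]|[q [_ [a [c [as_ sc h]]]]]].
  rewrite lt_neqAle m_lb // andbT; apply/eqP => ms; subst s.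
  by have [x [Kx mx xc]] := limit_near sc; apply: h Kx.
have [q' [ay ys]] := rat_between as_.
exact: le_lt_trans (m_lb (h _ ay (lt_trans ys sc))) ys.
Qed.

Lemma label_disjoint s : J s -> ~ D s.
Proof.
move=> [Ks [c [Kc sc h]]] [q [_ [a [c' [as_ sc' h']]]]].
have [|y [sy]] := @rat_between R s (Order.min c c'); first by rewrite lt_min sc.
rewrite lt_min => /andP[yc yc']; apply: (h (ratr y)) => //.
by apply: h' => //; apply: lt_trans sy.
Qed.

Lemma label_countable : countable (J `|` D).
Proof.
apply: countable_setU; last first.
  apply: (@countable_subset _ _ (range (@ratr R))).
    by move=> s [q [-> _]]; exists q.
  by apply: sub_countable (card_image_le _ _) _; exact: countableP.
have /choice[f fP] a : exists q : rat, J a -> a < ratr q /\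
    forall y, a < y -> y < ratr q -> ~ K y.
  have [[Ka [c [Kc ac h]]]|] := pselect (J a); last by exists 0%R.
  have [q [aq qc]] := rat_between ac; exists q => _; split=> // y ay yq.
  by apply: h => //; apply: lt_trans qc.
apply/countable_injP; exists (pickle \o f) => a a' /set_mem Ja /set_mem Ja'.
move=> /(pcan_inj pickleK) e; have [aq h] := fP a Ja; have [aq' h'] := fP a' Ja'.
have [aa'|aa'|//] := ltgtP a a'.
  by exfalso; apply: (h a') => //; [rewrite e | case: Ja'].
by exfalso; apply: (h' a) => //; [rewrite -e | case: Ja].
Qed.

(** Either the whole segment lies in [K] and contains a rational, or it has a point [x] outside [K];
    then the supremum of [K] below [x] is the left end of a gap. This is what makes distinct points
    of [K] index distinct sets. *)
Lemma label_between t t' : K t -> K t' -> t < t' ->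
  exists s, [/\ (J `|` D) s, t <= s & s < t'].
Proof.
move=> Kt Kt' tt'.
have [full|/existsNP[x /not_implyP[tx /not_implyP[xt' nKx]]]] :=
    pselect (forall x, t <= x -> x <= t' -> K x).
  have [q [tq qt']] := rat_between tt'.
  exists (ratr q); split; [right; exists q; split=> // | exact: ltW | by []].
  by exists t, t'; split=> // y ty yt'; apply: full; apply: ltW.
pose A := [set y | K y /\ y <= x]; pose B := [set y | K y /\ x <= y].
have At : A t by [].
have Bt' : B t' by [].
have hA : has_sup A by split; [exists t | exists x => y []].
have hB : has_inf B by split; [exists t' | exists x => y []].
have KA : K (sup A) by apply: compact_sup_mem => [y []|] //; exists t.
have KB : K (inf B) by apply: compact_inf_mem => [y []|] //; exists t'.
have Ax : sup A < x.
  rewrite lt_neqAle; apply/andP; split; first by apply/eqP => e; rewrite e in KA.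
  by apply: ge_sup => [|y []//]; exists t.
have xB : x < inf B.
  rewrite lt_neqAle; apply/andP; split; first by apply/eqP => e; rewrite -e in KB.
  by apply: lb_le_inf => [|y []//]; exists t'.
exists (sup A); split.
- left; split=> //; exists (inf B); split=> //; first exact: lt_trans xB.
  move=> y Ay yB Ky; have [xy|/ltW yx] := leP x y.
    by have := ge_inf hB.2 (conj Ky xy : B y); rewrite leNgt yB.
  by have := ub_le_sup hA.2 (conj Ky yx : A y); rewrite leNgt Ay.
- by apply: ub_le_sup => //; case: hA.
- exact: lt_le_trans Ax xt'.
Qed.

Lemma label_right_dense_min t : m < t ->
  exists s, [/\ (J `|` D) s, m < s & s < t].
Proof.
move=> /limit_near[x [Kx mx xt]]; have [s [Js _ sx]] := label_between Km Kx mx.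
by exists s; split=> //; [exact: label_gt | exact: lt_trans xt].
Qed.

Lemma label_right_dense_inner s t : D s -> s < t ->
  exists s', [/\ D s', s < s' & s' < t].
Proof.
move=> [_ [_ [a [c [as_ sc h]]]]] st.
have [|q [sq]] := @rat_between R s (Order.min c t); first by rewrite lt_min sc.
rewrite lt_min => /andP[qc qt]; exists (ratr q); split=> //.
by exists q; split=> //; exists a, c; split=> //; apply: lt_trans sq.
Qed.

(** A copy [B] comparable with the whole chain is squeezed between {phi < u} and {phi <= u}, where
    [u] is the supremum of the indices of the members inside [B]; compactness puts [u] into [K]. *)
Lemma maximal_chain_of_labelling (d : Order.disp_t) (X : porderType d)
    (phi : X -> R) : labelling J D m phi ->
  maximal_chain (copies X `|` [set set0])
    [set A | exists t, K t /\ A = [set x | phi x < t]].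
Proof.
move=> [lab onto cop gap].
have phi_m : [set x | phi x < m] = set0.
  by apply/seteqP; split=> // x /=; rewrite ltNge ltW // label_gt.
split.
- move=> _ [t [Kt ->]]; have := m_lb Kt; rewrite le_eqVlt => /orP[/eqP <-|mt].
    by right.
  by left; apply: cop.
- move=> _ _ [t [_ ->]] [t' [_ ->]]; have [tt'|t't] := leP t t'.
    by left=> x /= xt; apply: lt_le_trans tt'.
  by right=> x /= xt; apply: lt_trans t't.
move=> E EP Etot CE; apply/seteqP; split; last exact: CE.
move=> B EB.
pose T := [set t | K t /\ [set x | phi x < t] `<=` B].
have Tm : T m by split=> //; rewrite phi_m.
have hT : has_sup T.
  split; first by exists m.
  by have [M MP] := compact_has_ubound; exists M => t [/MP].
set u := sup T.
have Ku : K u by apply: compact_sup_mem => [t []|] //; exists m.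
have uB : [set x | phi x < u] `<=` B.
  by move=> x /= /(sup_gt hT.1)[t [Kt tB] xt]; apply: tB.
have Bu : B `<=` [set x | phi x <= u].
  move=> x Bx /=; rewrite leNgt; apply/negP => ux.
  have Kx := label_mem (lab x).
  have [xB|Bx'] := Etot _ _ (CE _ (ex_intro _ (phi x) (conj Kx erefl))) EB.
    by have := ub_le_sup hT.2 (conj Kx xB : T (phi x)); rewrite leNgt ux.
  by have := Bx' _ Bx; rewrite /= ltxx.
have [cB|->] := EP B EB; last by exists m.
have [->|[[_ [c [Kc uc hc]]] ->]] := gap u B cB uB Bu; first by exists u.
(* Labels belong to [K] and none falls into the gap between [u] and [c], so {phi <= u} is the member
   {phi < c}. *)
exists c; split=> //; apply/seteqP; split=> x /= h; first exact: le_lt_trans uc.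
rewrite leNgt; apply/negP => ux; apply: (hc (phi x)) => //.
by apply: label_mem.
Qed.

Lemma chain_strict (d : Order.disp_t) (X : porderType d) (phi : X -> R) s t :
  labelling J D m phi -> K s -> K t ->
  s < t <-> [set x | phi x < s] `<` [set x | phi x < t].
Proof.
move=> [_ onto _ _] Ks Kt.
have main u v : K u -> K v -> u < v -> exists x : X, u <= phi x /\ phi x < v.
  move=> Ku Kv uv; have [w [Jw uw wv]] := label_between Ku Kv uv.
  by have [x xw] := onto w Jw; exists x; rewrite xw.
split=> [st|[sub nsub]]; last first.
  rewrite ltNge; apply/negP => ts; apply: nsub => x /= xt.
  exact: lt_le_trans ts.
split=> [x /= xs|sub]; first exact: lt_trans st.
have [x [sx xt]] := main s t Ks Kt st.
by have := sub x xt; rewrite /= ltNge sx.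
Qed.

End CompactLabels.

Lemma compact_iso_maximal_chain (R : realType) (d : Order.disp_t)
    (X : porderType d) (d' : Order.disp_t) (L : orderType d') (K : set R) :
  countable [set: X] -> infinite_set [set: X] -> homogeneous X ->
  (inner_rational K !=set0 -> exists x y : X, x < y) ->
  compact K -> min_accumulation K ->
  isomorphic (@slt d' L) (@slt _ R) setT K ->
  iso_maximal_chain_of_copies X L.
Proof.
move=> Xc Xi hom nonanti cK [m [Km mlb mlim]] [f [[fK finj fsurj] fmono]].
have [phi phiP] := @labelling_exists R d X (gap_left K) (inner_rational K) m Xc
  Xi hom (label_countable K) (@label_disjoint R K)
  (label_gt mlb mlim) (label_right_dense_min cK Km mlb mlim)
  (@label_right_dense_inner R K) nonanti.
exists [set A | exists t, K t /\ A = [set x | phi x < t]].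
  exact: maximal_chain_of_labelling cK Km mlb mlim _ _ _ phiP.
have strict x y := chain_strict cK mlb phiP (fK x I) (fK y I).
exists (fun x => [set z | phi z < f x]); split.
  split.
  - by move=> x _; exists (f x); split=> //; apply: fK.
  - move=> x y _ _ e; have [xy|yx|//] := ltgtP x y.
      have /(strict x y) := (fmono x y I I).1 xy; rewrite e => -[_ h].
      by case: h.
    have /(strict y x) := (fmono y x I I).1 yx; rewrite e => -[_ h].
    by case: h.
  - by move=> _ [t [/fsurj[x _ <-] ->]]; exists x.
move=> x y _ _; split=> [/(fmono x y I I)/(strict x y)//|/(strict x y) xy].
exact/(fmono x y I I).
Qed.

(** * From maximal chains to complete orders *)

Lemma antichain_homogeneous (d : Order.disp_t) (X : porderType d) :
  infinite_set [set: X] -> antichain X -> homogeneous X.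
Proof.
move=> Xinf anti p pp x.
have nlt (y z : X) : (y < z) = false by apply/negP/anti.
have [/mapP[u up ->]|xp] := boolP (x \in map fst p).
  exists u.2; apply: piso_cons => // v vp; rewrite !nlt; split=> //.
  by have [] := pisoP _ pp v u vp up.
have [y [_ yp]] := infinite_fresh (map snd p) Xinf.
exists y; apply: piso_cons => // u up; rewrite !nlt; split=> //.
apply/eqP/eqP => e.
  by case/negP: xp; rewrite -e map_f.
by case/negP: yp; rewrite -e map_f.
Qed.

(** Reciprocals of positive integers serve as labels and [D] is empty, so antichains are covered
    too; {phi < 1} omits the element labelled 1. *)
Lemma proper_copy (R : realType) (d : Order.disp_t) (X : porderType d) :
  countable [set: X] -> infinite_set [set: X] -> homogeneous X ->
  exists A x, copies X A /\ ~ A x.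
Proof.
move=> Xc Xi hom.
pose J : set R := range (fun n : nat => n.+1%:R^-1)%R.
have [||||||phi [_ onto cop _]] :=
  @labelling_exists R d X J set0 0%R Xc Xi hom.
- by rewrite setU0; apply: sub_countable (card_image_le _ _) _; exact: countableP.
- by move=> s _ [].
- by move=> _ [[n _ <-]|//]; rewrite invr_gt0 ltr0n.
- move=> t t0; exists ((Num.truncn t^-1).+1%:R^-1)%R; split.
  + by left; exists (Num.truncn t^-1).
  + by rewrite invr_gt0 ltr0n.
  + by rewrite invf_plt ?posrE ?ltr0n //; exact: truncnS_gt.
- by [].
- by move=> [s []].
have [|x x1] := onto 1%R; first by left; exists 0%N; rewrite // invr1.
exists [set y | phi y < 1%R], x; split; first exact: cop ltr01.
by rewrite /= x1 ltxx.
Qed.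

Lemma copies_proper_subset (R : realType) (d : Order.disp_t) (X : porderType d)
    (S : set X) :
  countable [set: X] -> infinite_set [set: X] -> homogeneous X ->
  copies X S -> exists B, copies X B /\ B `<` S.
Proof.
move=> Xc Xi hom [f [[fS finj fsurj] fm]].
have [A [x [[g [[gA ginj gsurj] gm]] nAx]]] := proper_copy R Xc Xi hom.
exists (f @` A); split; last first.
  split; first by move=> _ [y _ <-]; apply: fS.
  move=> /(_ (f x) (fS x I))[y Ay] /finj yx; apply: nAx.
  by rewrite -yx // in_setT.
exists (f \o g); split; last first.
  by move=> y z _ _; rewrite (gm y z I I) (fm (g y) (g z) I I).
split.
- by move=> y _; exists (g y) => //; apply: gA.
- by move=> y z Ty Tz /finj e; apply: ginj => //; apply: e; rewrite in_setT.
- by move=> _ [y /gsurj[z _ <-] <-]; exists z.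
Qed.

(** * Binary weights of sets of natural numbers *)

Section BinaryWeight.
Context (R : realType).
Local Open Scope ring_scope.
Implicit Types (P Q : set nat) (n k : nat).

Definition partial_weight P n : R := \sum_(i < n | `[< P i >]) 2^-1 ^+ i.

Definition weight P : R := sup (range (partial_weight P)).

Lemma partial_weight_le2 P n : partial_weight P n <= 2.
Proof.
have half_ge0 k : (0 : R) <= 2^-1 ^+ k by rewrite exprn_ge0 // invr_ge0.
apply: (@le_trans _ _ (\sum_(i < n) 2^-1 ^+ i)).
  by rewrite /partial_weight big_mkcond; apply: ler_sum => i _; case: ifP.
suff e : \sum_(i < n) 2^-1 ^+ i + 2 * 2^-1 ^+ n = 2 :> R.
  by rewrite -[leRHS]e lerDl mulr_ge0.
elim: n => [|n IH]; first by rewrite big_ord0 expr0 mulr1 add0r.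
rewrite big_ord_recr -addrA -[RHS]IH; congr (_ + _).
by rewrite exprS mulrA divff ?pnatr_eq0 // mul1r mulr_natl mulr2n.
Qed.

Lemma partial_weight_mono P k n : (k <= n)%N ->
  partial_weight P k <= partial_weight P n.
Proof.
move=> kn; rewrite /partial_weight.
rewrite -!(big_mkord (fun i => `[< P i >]) (fun i => 2^-1 ^+ i)).
by rewrite [leRHS](@big_cat_nat _ _ _ k) //= lerDl sumr_ge0.
Qed.

Lemma has_sup_weight P : has_sup (range (partial_weight P)).
Proof.
split; first by exists (partial_weight P 0%N), 0%N.
by exists 2 => _ [n _ <-]; exact: partial_weight_le2.
Qed.

(** A new element [k] contributes its own term to all partial sums beyond [k], so the gap survives
    the passage to suprema. *)
Lemma weight_lt P Q : P `<` Q -> weight P < weight Q.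
Proof.
move=> [PQ /existsNP[k /not_implyP[Qk nPk]]].
have k0 : (0 : R) < 2^-1 ^+ k by rewrite exprn_gt0 // invr_gt0.
suff : weight P <= weight Q - 2^-1 ^+ k.
  by move=> h; apply: le_lt_trans h _; rewrite ltrBlDr ltrDl.
apply: ge_sup; first by exists (partial_weight P 0%N), 0%N.
move=> _ [n _ <-]; rewrite lerBrDr.
pose N := maxn n k.+1.
have kN : (k < N)%N by rewrite leq_max leqnn orbT.
apply: (@le_trans _ _ (partial_weight Q N)); last first.
  by apply: ub_le_sup; [case: (has_sup_weight Q) | exists N].
apply: (@le_trans _ _ (partial_weight P N + 2^-1 ^+ k)).
  by rewrite lerD2r; apply: partial_weight_mono; rewrite leq_maxl.
rewrite /partial_weight [leRHS](bigD1 (Ordinal kN)) /=; last exact/asboolP.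
rewrite [leRHS]addrC lerD2r big_mkcond [leRHS]big_mkcond /=.
apply: ler_sum => i _; case: asboolP => Pi; last first.
  by case: ifP => // _; rewrite exprn_ge0 // invr_ge0.
rewrite (asboolT (PQ _ Pi)) /=; case: eqP => // ik.
by case: nPk; rewrite ik in Pi.
Qed.

End BinaryWeight.

Section MaximalChain.
Context (d d' : Order.disp_t) (X : porderType d) (L : orderType d').
Context (C : set (set X)) (g : L -> set X).
Hypothesis Xc : countable [set: X].
Hypothesis Xi : infinite_set [set: X].
Hypothesis hom : homogeneous X.
Hypothesis Cmax : maximal_chain (copies X `|` [set set0]) C.
Hypothesis giso : is_iso (@slt d' L) (fun A B : set X => A `<` B) setT C g.
Implicit Types (x y z : L).

Let gC x : C (g x). Proof. by case: giso => -[gT _ _] _; exact: gT. Qed.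

Let glt x y : x < y <-> g x `<` g y.
Proof. by case: giso => _; apply. Qed.

Let gP x : copies X (g x) \/ g x = set0.
Proof. by case: Cmax => CP _ _; exact: CP (gC x). Qed.

Let gle x y : x <= y <-> g x `<=` g y.
Proof.
split=> [|xy].
  by rewrite le_eqVlt => /orP[/eqP -> //|/glt[]].
by rewrite leNgt; apply/negP => /glt[].
Qed.

Lemma maximal_chain_mem B : copies X B \/ B = set0 ->
  (forall x, g x `<=` B \/ B `<=` g x) -> exists x, g x = B.
Proof.
case: giso => -[_ _ gsurj] _; case: Cmax => CP Ctot CM BP Bcmp.
suff CB : C B by have [x _ xB] := gsurj B CB; exists x.
rewrite -(CM (C `|` [set B])); last 1 first.
- by move=> A CA; left.
- by right.
- by move=> A [/CP|->].
- move=> A A' [CA|->] [CA'|->]; first exact: Ctot.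
  + by have [x _ <-] := gsurj A CA; exact: Bcmp.
  + by have [x _ <-] := gsurj A' CA'; have [] := Bcmp x; [right | left].
  + by left.
Qed.

Lemma maximal_chain_union (A : set L) : A !=set0 ->
  exists u, g u = \bigcup_(a in A) g a.
Proof.
move=> [a0 Aa0]; set U := \bigcup_(a in A) g a.
have [[a Aa ga]|allempty] := pselect (exists2 a, A a & g a !=set0); last first.
  apply: maximal_chain_mem.
    right; apply/seteqP; split=> // p [a Aa gap].
    by case: allempty; exists a => //; exists p.
  move=> x; right=> p [a Aa gap]; by case: allempty; exists a => //; exists p.
apply: maximal_chain_mem.
  left; apply: realizes_types_copy => // F x FU xF.
  (* One member of the chain contains all of [F]. Keeping [c] above [a] ensures that this member is
     nonempty, hence a copy. *)
  have [c [Ac Fc ac]] : exists c, [/\ A c, forall f, f \in F -> g c f & a <= c].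
    elim: F FU {xF} => [|f F IH] FU; first by exists a.
    have [|c [Ac Fc ac]] := IH; first by move=> h hF; apply: FU; rewrite inE hF orbT.
    have [e Ae fe] := FU f (mem_head _ _).
    have [ce|ec] := leP c e.
      exists e; split=> //; last exact: le_trans ce.
      move=> h; rewrite inE => /orP[/eqP -> //|/Fc].
      exact: (gle c e).1 ce h.
    exists c; split=> // h; rewrite inE => /orP[/eqP ->|/Fc //].
    exact: (gle e c).1 (ltW ec) f fe.
  have [cc|c0] := gP c.
    have rc := copy_realizes_types hom cc.
    have [y [cy yF xy]] := rc F x Fc xF.
    by exists y; split=> //; exists c.
  have [p pa] := ga; have := (gle a c).1 ac p pa; by rewrite c0.
move=> x; have [[a' Aa' xa']|no] := pselect (exists2 a, A a & x <= a).
  by left=> p xp; exists a' => //; apply: (gle x a').1 xa' p xp.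
right=> p [a' Aa' a'p]; apply: (gle a' x).1 a'p.
by rewrite leNgt; apply/negP => /ltW xa'; apply: no; exists a'.
Qed.

Lemma maximal_chain_embeddable (R : realType) : embeddable_in R L.
Proof.
have [e /in2TT einj] := countable_injP _ Xc.
have main x y : x < y -> weight R (e @` g x) < weight R (e @` g y).
  move=> /glt[xy nyx]; apply: weight_lt; split; first exact: image_subset.
  move=> yx; apply: nyx => p yp.
  by have [q xq /einj <-] := yx (e p) (imageP e yp).
exists (fun x => weight R (e @` g x)) => x y.
apply/idP/idP; last exact: main.
by apply: contraTT; rewrite -!leNgt le_eqVlt => /orP[/eqP ->//|/main/ltW].
Qed.

Let bottom : exists z, g z = set0.
Proof. by apply: maximal_chain_mem => [|x]; right. Qed.

Let top : exists u, g u = setT.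
Proof.
apply: maximal_chain_mem => [|x]; left=> //.
by apply: realizes_types_copy => //; exact: realizes_types_setT.
Qed.

Lemma maximal_chain_complete : complete_order L.
Proof.
split.
- by have [z z0] := bottom; exists z => x; apply/gle; rewrite z0.
- by have [u uT] := top; exists u => x; apply/gle; rewrite uT.
move=> A B [A0 [b0 Bb0] ABT AB].
have [u uU] := maximal_chain_union A0.
have [Au|Bu] : (A `|` B) u by rewrite ABT.
  left; exists u => // a Aa; apply/gle; rewrite uU => p ap; by exists a.
right; exists u => // b Bb; apply/gle; rewrite uU => p [a Aa].
by apply: (gle a b).1; apply/ltW/AB.
Qed.

(** An immediate successor of the empty set would be a copy, and a proper subcopy of it would be
    comparable with every member, hence itself a member. *)
Lemma maximal_chain_bottom (R : realType) : bottom_nonisolated L.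
Proof.
have [z z0] := bottom; have zle x : z <= x by apply/gle; rewrite z0.
have lt0 x : z < x <-> g x !=set0.
  split=> [/glt[_]|[p xp]].
    by rewrite z0 => h; apply: contrapT => /nonemptyPn x0; apply: h; rewrite x0.
  by apply/glt; rewrite z0; split=> // /(_ p xp).
exists z; split=> //.
  have [u uT] := top; exists u; apply/lt0; rewrite uT.
  exact: infinite_setN0.
move=> [s [/lt0[p sp] jump]].
have [cs|s0] := gP s; last by rewrite s0 in sp.
have [B [cB [Bs nsB]]] := copies_proper_subset R Xc Xi hom cs.
have [x xB] : exists x, g x = B.
  apply: maximal_chain_mem; first by left.
  move=> x; have [sx|xs] := leP s x.
    by right=> q Bq; apply: (gle s x).1 sx q (Bs q Bq).
  left=> q xq; case: jump; exists x.
  by apply/andP; split=> //; apply/lt0; exists q.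
apply: jump; exists x; apply/andP; split.
  apply/lt0; rewrite xB; have [f [[fB _ _] _]] := cB.
  by exists (f p); apply: fB.
by apply/glt; rewrite xB.
Qed.

(** Fix [p] in [g y] but not in [g w]. The union of all members that omit [p] is a member [g u], and
    adding the single point [p] to it again gives a copy, as there are no comparabilities; these two
    form a jump. The detour through a nonempty [g w] guarantees that [g u] is a copy rather than
    empty. *)
Lemma antichain_dense_jumps (R : realType) : antichain X -> dense_jumps L.
Proof.
move=> anti x y xy.
have [z [zle _ nojump]] := maximal_chain_bottom R.
have gz : g z = set0.
  by have [w w0] := bottom; have := (gle z w).1 (zle w); rewrite w0 subset0.
have [w [xw wy w0]] : exists w, [/\ x <= w, w < y & g w !=set0].
  have nz v : z != v -> g v !=set0.
    move=> zv; apply: contrapT => /nonemptyPn v0; move/eqP: zv; apply.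
    by apply/le_anti; rewrite zle /=; apply/gle; rewrite v0.
  have [xz|xz] := eqVneq z x; last by exists x; split=> //; exact: nz.
  have [w /andP[zw wy]] : exists w, z < w < y.
    by apply: contrapT => no; apply: nojump; exists y; split; rewrite // xz.
  exists w; split=> //; first by rewrite -xz.
  by apply: nz; rewrite lt_eqF.
have /glt[_ /existsNP[p /not_implyP[yp nwp]]] := wy.
have [|u uU] := @maximal_chain_union [set v | ~ g v p]; first by exists w.
have nup : ~ g u p by rewrite uU => -[].
have leu v : ~ g v p -> g v `<=` g u by move=> nvp; rewrite uU => q vq; exists v.
have wu := leu w nwp.
have cu : copies X (g u).
  by have [//|u0] := gP u; have [q /wu] := w0; rewrite u0.
have nlt (q r : X) : (q < r) = false by apply/negP/anti.
have [v vU] : exists v, g v = g u `|` [set p].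
  apply: maximal_chain_mem.
    left; apply: realizes_types_copy => // F q FU qF.
    have ru := copy_realizes_types hom cu.
    have [||r [ur rF _]] := ru [seq f <- F | `[< g u f >]] q.
    - by move=> f; rewrite mem_filter => /andP[/asboolP].
    - by rewrite mem_filter negb_and qF orbT.
    exists r; split; [by left | |].
      by apply: contra rF => rF; rewrite mem_filter rF andbT; apply/asboolP.
    by apply/same_typeP => f _; rewrite !nlt.
  move=> v; have [vp|nvp] := pselect (g v p); last first.
    by left=> q /(leu v nvp); left.
  right=> q [uq|->//].
  have [uv|/ltW/gle vu] := leP u v; first exact: (gle u v).1 uv q uq.
  by case: nup; apply: vu.
have uv : u < v by apply/glt; rewrite vU; split=> [q ?|h]; [left | apply/nup/h; right].
exists u, v; split.
- by apply: le_trans xw _; apply/gle.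
- split=> // -[t /andP[/glt[ut ntu] /glt[]]]; rewrite vU => tv ntv.
  have [tp|ntp] := pselect (g t p); first by apply: ntv => q [/ut|->].
  by apply: ntu; exact: leu.
- apply/gle; rewrite vU => q [uq|->//].
  have [uy|/ltW/gle yu] := leP u y; first exact: (gle u y).1 uy q uq.
  by case: nup; apply: yu.
Qed.

End MaximalChain.

(** * From complete orders to compact sets *)

Section CompactRepresentation.
Context (R : realType) (d : Order.disp_t) (L : orderType d).
Hypothesis Lemb : embeddable_in R L.
Hypothesis Lcomplete : complete_order L.
Hypothesis Lbottom : bottom_nonisolated L.
Implicit Types (a b s x y z : L) (p : seq (L * R)).

(** One point is chosen for each rational interval that meets the image of [f]. Jumps are countable
    because a rational inside the image of a jump determines it, so both ends of every jump can be
    listed. *)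
Lemma countable_order_dense : exists h : nat -> L,
  (forall x y, x < y -> ~ is_jump x y -> exists n, x < h n /\ h n < y) /\
  (forall x y, is_jump x y -> (exists n, h n = x) /\ (exists n, h n = y)).
Proof.
have [f fmono] := Lemb; have [z _] := Lbottom.
have /choice[c1 c1P] (q : rat * rat) : exists y, forall x,
    ratr q.1 < f x -> f x < ratr q.2 -> ratr q.1 < f y /\ f y < ratr q.2.
  have [[y [qy yq]]|no] := pselect (exists y, ratr q.1 < f y /\ f y < ratr q.2).
    by exists y.
  by exists z => x qx xq; case: no; exists x.
have /choice[c2 c2P] (q : rat) : exists ab : L * L, forall a b,
    is_jump a b -> f a < ratr q -> ratr q < f b -> ab = (a, b).
  have [[a [b [jab aq qb]]]|no] :=
      pselect (exists a b, [/\ is_jump a b, f a < ratr q & ratr q < f b]); last first.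
    by exists (z, z) => a b jab aq qb; case: no; exists a, b.
  exists (a, b) => a' b' [ab' no'] aq' qb'; case: jab => ab no.
  have lt1 : a' < b by rewrite -fmono; apply: lt_trans qb.
  have lt2 : a < b' by rewrite -fmono; apply: lt_trans qb'.
  have le1 : a <= a'.
    by rewrite leNgt; apply/negP => aa; apply: no'; exists a; rewrite aa lt2.
  have le2 : a' <= a.
    by rewrite leNgt; apply/negP => aa; apply: no; exists a'; rewrite aa lt1.
  have le3 : b <= b'.
    by rewrite leNgt; apply/negP => aa; apply: no; exists b'; rewrite aa lt2.
  have le4 : b' <= b.
    by rewrite leNgt; apply/negP => aa; apply: no'; exists b; rewrite aa lt1.
  by congr (_, _); apply/le_anti; rewrite ?le1 ?le2 ?le3 ?le4.
pose h n := match unpickle n : option (rat * rat + rat + rat) with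
  | Some (inl (inl q)) => c1 q | Some (inl (inr q)) => (c2 q).1
  | Some (inr q) => (c2 q).2 | None => z end.
exists h; split => [x y xy nj|x y [xy nj]].
  have [t /andP[xt ty]] : exists t, x < t < y.
    by apply: contrapT => no; apply: nj.
  have [q [xq qt]] := rat_between (etrans (fmono x t) xt).
  have [q' [tq' q'y]] := rat_between (etrans (fmono t y) ty).
  exists (pickle (inl (inl (q, q')) : rat * rat + rat + rat)).
  rewrite /h pickleK -!fmono; have [c1q c1q'] := c1P (q, q') t qt tq'.
  by split; [exact: lt_trans c1q | exact: lt_trans q'y].
have [q [xq qy]] := rat_between (etrans (fmono x y) xy).
have e := c2P q x y (conj xy nj) xq qy.
split.
  by exists (pickle (inl (inr q) : rat * rat + rat + rat)); rewrite /h pickleK e.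
by exists (pickle (inr q : rat * rat + rat + rat)); rewrite /h pickleK e.
Qed.

(** The conditions are finite strictly increasing maps into [0, 1] in which exactly the two end
    points of [L] take the values 0 and 1. The generic map is defined on a countable set of points
    and extended by suprema. *)
Lemma gap_filling_map : exists g : L -> R,
  [/\ {mono g : x y / x < y}, exists z, g z = 0%R, exists u, g u = 1%R,
      forall x, 0%R <= g x <= 1%R &
      forall q : rat, (0%R < ratr q :> R) -> (ratr q < 1%R :> R) ->
        (exists x, g x = ratr q) \/
        exists a b, [/\ is_jump a b, g a < ratr q & ratr q < g b]].
Proof.
have [h [hdense hjump]] := countable_order_dense.
have [z [zle [z' zz'] nojump]] := Lbottom.
have [_ [u ule] _] := Lcomplete.
have zu : z < u by apply: lt_le_trans zz' (ule z').
pose good p := forall v, v \in p -> [/\ (v.1 == z) = (v.2 == 0%R),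
   (v.1 == u) = (v.2 == 1%R), 0%R <= v.2, v.2 <= 1%R &
   forall w, w \in p -> (v.1 < w.1) = (v.2 < w.2)].
have good_cons p x t : good p -> (x == z) = (t == 0%R) -> (x == u) = (t == 1%R) ->
    0%R <= t -> t <= 1%R -> (forall v, v \in p -> v.1 < x /\ v.2 < t \/ x < v.1 /\ t < v.2) ->
    good ((x, t) :: p).
  move=> gp xz xu t0 t1 sep v; rewrite inE => /orP[/eqP ->|vp].
    split=> // w; rewrite inE => /orP[/eqP ->|/sep] /=; first by rewrite !ltxx.
    by move=> [[/ltW h1 /ltW h2]|[-> ->] //]; rewrite !ltNge h1 h2.
  have [v1 v2 v3 v4 v5] := gp v vp; split=> // w.
  rewrite inE => /orP[/eqP ->|/v5 //] /=.
  by have [[-> ->]|[/ltW h1 /ltW h2]] := sep v vp; rewrite // !ltNge h1 h2.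
have add p x : good p -> exists q, [/\ good q, {subset p <= q} & x \in map fst q].
  move=> gp; have [xp|xp] := boolP (x \in map fst p); first by exists p; split.
  have neq v : v \in p -> v.1 < x \/ x < v.1.
    move=> vp; have [|| e] := ltgtP v.1 x; [by left | by right |].
    by case/negP: xp; rewrite -e map_f.
  suff [t gt] : exists t, good ((x, t) :: p).
    exists ((x, t) :: p); split=> //; last by rewrite inE eqxx.
    by move=> v vp; rewrite inE vp orbT.
  have pos v : v \in p -> z < v.1 -> 0%R < v.2.
    move=> vp zv; have [e _ v0 _ _] := gp v vp.
    by rewrite lt_neqAle v0 andbT eq_sym -e gt_eqF.
  have lt1 v : v \in p -> v.1 < u -> v.2 < 1%R.
    move=> vp vu; have [_ e _ v1 _] := gp v vp.
    by rewrite lt_neqAle v1 andbT -e lt_eqF.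
  have [xz|xz] := eqVneq x z.
    exists 0%R; apply: good_cons => //; rewrite ?xz ?eqxx ?ler01 //.
      by rewrite (lt_eqF zu) eq_sym oner_eq0.
    move=> v vp; right; have [|] := neq v vp; rewrite xz; first by rewrite ltNge zle.
    by move=> zv; split=> //; exact: pos.
  have [xu|xu] := eqVneq x u.
    exists 1%R; apply: good_cons => //; rewrite ?xu ?eqxx ?ler01 //.
      by rewrite (gt_eqF zu) oner_eq0.
    move=> v vp; left; have [|] := neq v vp; rewrite xu; last by rewrite ltNge ule.
    by move=> zv; split=> //; exact: lt1.
  have [m [mp mP]] := seq_max 0%R [seq v.2 | v <- p & v.1 < x].
  have [m0 m1 mup] : [/\ 0%R <= m, m < 1%R & forall v, v \in p -> x < v.1 -> m < v.2].
    move: mp; rewrite inE => /orP[/eqP ->|/mapP[w + ->]].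
      split=> // v vp xv.
      by apply: pos => //; apply: le_lt_trans (zle x) xv.
    rewrite mem_filter => /andP[wx wp]; have [_ _ w0 _ wlt] := gp w wp.
    split=> // [|v vp xv]; first by apply: lt1 => //; apply: lt_le_trans wx (ule x).
    by rewrite -wlt //; apply: lt_trans xv.
  have [M [mM M1 MP]] := seq_lower_bound (map snd p) m1.
  have [q [mq qM]] := rat_between mM.
  exists (ratr q); apply: good_cons => //.
  - by rewrite (negbTE xz) gt_eqF // (le_lt_trans m0).
  - by rewrite (negbTE xu) lt_eqF // (lt_le_trans qM).
  - exact/ltW/(le_lt_trans m0).
  - exact/ltW/(lt_le_trans qM).
  - move=> v vp; have [vx|xv] := neq v vp.
      left; split=> //; apply: le_lt_trans mq; apply: mP; rewrite inE.
      by apply/orP; right; apply/mapP; exists v; rewrite // mem_filter vx.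
    right; split=> //; apply: lt_le_trans qM _; apply: MP; first exact: map_f.
    exact: mup.
pose task (i : nat + rat + bool) p := match i with
  | inr c => (if c then z else u) \in map fst p
  | inl (inl n) => h n \in map fst p
  | inl (inr q) => 0%R < (ratr q : R) -> (ratr q : R) < 1%R -> ratr q \in map snd p \/
     exists a b : L * R, [/\ is_jump a.1 b.1, a \in p, b \in p &
       (a.2 < ratr q) && (ratr q < b.2)]
  end : Prop.
have [|||G [Gfin GT]] := @generic_filter _ good _ pickle task.
- exact: pcan_inj pickleK.
- by [].
- move=> [[n|q]|c] p gp; [exact: add | | exact: add].
  have [p1 [gp1 pp1 zp1]] := add p z gp.
  have [r [gr p1r ur]] := add p1 u gp1.
  have pr : {subset p <= r} by move=> v /pp1/p1r.
  have zr : z \in map fst r.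
    by have /mapP[v vp ->] := zp1; rewrite map_f // p1r.
  have [qr|qr] := boolP (ratr q \in map snd r).
    by exists r; split=> // _ _; left.
  have [q0|q0] := boolP (0%R < (ratr q : R)); last first.
    by exists r; split=> //= q0'; rewrite q0' in q0.
  have [q1|q1] := boolP ((ratr q : R) < 1%R); last first.
    by exists r; split=> //= _ q1'; rewrite q1' in q1.
  have [v0 v0r v0z] := mapP zr; have [v1 v1r v1u] := mapP ur.
  have [a [ar aq aP]] : exists a : L * R, [/\ a \in r, a.2 < ratr q &
      forall v, v \in r -> v.2 < ratr q -> v.1 <= a.1].
    have [m [mr mP]] := seq_max z [seq v.1 | v <- r & v.2 < ratr q].
    have v0q : v0.2 < ratr q.
      by have [e _ _ _ _] := gr v0 v0r; move: e; rewrite -v0z eqxx => /esym/eqP ->.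
    have [a ar [aq am]] : exists2 a : L * R, a \in r & a.2 < ratr q /\ m = a.1.
      move: mr; rewrite inE => /orP[/eqP ->|/mapP[a]]; first by exists v0.
      by rewrite mem_filter => /andP[? ?] ->; exists a.
    exists a; split=> // v vr vq; rewrite -am; apply: mP; rewrite inE.
    by apply/orP; right; apply/mapP; exists v; rewrite // mem_filter vq.
  have [b [br qb bP]] : exists b : L * R, [/\ b \in r, ratr q < b.2 &
      forall v, v \in r -> ratr q < v.2 -> b.1 <= v.1].
    have [m [mr mP]] := @seq_max _ L^d u [seq v.1 | v <- r & ratr q < v.2].
    have v1q : ratr q < v1.2.
      by have [_ e _ _ _] := gr v1 v1r; move: e; rewrite -v1u eqxx => /esym/eqP ->.
    have [b br [bq bm]] : exists2 b : L * R, b \in r & ratr q < b.2 /\ m = b.1.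
      move: mr; rewrite inE => /orP[/eqP ->|/mapP[b]]; first by exists v1.
      by rewrite mem_filter => /andP[? ?] ->; exists b.
    exists b; split=> // v vr vq; rewrite -bm; apply: mP; rewrite inE.
    by apply/orP; right; apply/mapP; exists v; rewrite // mem_filter vq.
  have ab : a.1 < b.1.
    by have [_ _ _ _ alt] := gr a ar; rewrite alt //; apply: lt_trans qb.
  (* The points [a.1] and [b.1] are the neighbours of the rational in the current condition. If they
     form a jump, the rational is separated; otherwise a point between them can be sent to it. *)
  have [jab|njab] := pselect (is_jump a.1 b.1).
    by exists r; split=> //= _ _; right; exists a, b; rewrite aq qb.
  have [y /andP[ay yb]] : exists y, a.1 < y < b.1.
    by apply: contrapT => no; apply: njab.
  exists ((y, ratr q) :: r); split.
  + apply: good_cons => //.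
    * by rewrite !gt_eqF // (le_lt_trans (zle a.1)).
    * by rewrite !lt_eqF // (lt_le_trans yb).
    * exact: ltW.
    * exact: ltW.
    * move=> v vr; have [vq|qv|e] := ltgtP v.2 (ratr q).
      - by left; split=> //; apply: le_lt_trans (aP v vr vq) ay.
      - by right; split=> //; apply: lt_le_trans yb (bP v vr qv).
      - by case/negP: qr; rewrite -e map_f.
  + by move=> v /pr vr; rewrite inE vr orbT.
  + by move=> _ _; left; rewrite inE eqxx.
have G2 (v w : L * R) : G v -> G w -> [/\ (v.1 == z) = (v.2 == 0%R), (v.1 == u) = (v.2 == 1%R),
    0%R <= v.2, v.2 <= 1%R & (v.1 < w.1) = (v.2 < w.2)].
  move=> Gv Gw; have [|p [gp sp _]] := Gfin [:: v; w].
    by move=> x; rewrite !inE => /orP[]/eqP ->.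
  have vp : v \in p by apply: sp; rewrite !inE eqxx.
  have wp : w \in p by apply: sp; rewrite !inE eqxx orbT.
  by have [? ? ? ? vlt] := gp v vp; split=> //; apply: vlt.
have Gdom i x : (forall p, task i p -> x \in map fst p) -> exists t, G (x, t).
  move=> ix; have [p [_ /ix/mapP[[y t] yp /= ->] pG]] := GT i.
  by exists t; apply: pG.
have Gz : G (z, 0%R).
  have [//|t Gt] := Gdom (inr true) z; have [+ _ _ _ _] := G2 _ _ Gt Gt.
  by rewrite eqxx => /esym/eqP <-.
have Gu : G (u, 1%R).
  have [//|t Gt] := Gdom (inr false) u; have [_ + _ _ _] := G2 _ _ Gt Gt.
  by rewrite eqxx => /esym/eqP <-.
have Gh n : exists t, G (h n, t) by exact: (Gdom (inl (inl n))).
pose T x := [set t | exists s, G (s, t) /\ s <= x].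
have hT x : has_sup (T x).
  split; first by exists 0%R, z.
  by exists 1%R => t [s [Gs _]]; have [_ _ _ + _] := G2 _ _ Gs Gs.
pose g x := sup (T x).
have gG x t : G (x, t) -> g x = t.
  move=> Gx; apply/le_anti/andP; split; last first.
    by apply: ub_le_sup; [case: (hT x) | exists x].
  apply: ge_sup; first by case: (hT x).
  move=> t' [s [Gs sx]]; rewrite leNgt.
  by have [_ _ _ _ /= <-] := G2 _ _ Gx Gs; rewrite -leNgt.
have gle x y : x <= y -> g x <= g y.
  move=> xy; apply: ge_sup; first by case: (hT x).
  move=> t [s [Gs sx]]; apply: ub_le_sup; first by case: (hT y).
  by exists s; split=> //; apply: le_trans xy.
have Glt x y t t' : G (x, t) -> G (y, t') -> x < y -> g x < g y.
  move=> Gx Gy; rewrite (gG _ _ Gx) (gG _ _ Gy).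
  by have [_ _ _ _ /= <-] := G2 _ _ Gx Gy.
have gjump x y : is_jump x y -> g x < g y.
  move=> jxy; have [[n xn] [k yk]] := hjump x y jxy.
  have [t Gt] := Gh n; have [t' Gt'] := Gh k; rewrite -xn -yk.
  by apply: Glt Gt Gt' _; rewrite xn yk; case: jxy.
have glt x y : x < y -> g x < g y.
  (* The extension by suprema is strict between two points of the generic domain. If no jump helps,
     two such points lie in []x, y[]: one between [x] and [y], and a second one between [x] and the
     first. *)
  move=> xy; have [/gjump //|njump] := pselect (is_jump x y).
  have [n [xn ny]] := hdense x y xy njump; apply: lt_le_trans (gle _ _ (ltW ny)).
  have [/gjump //|njump'] := pselect (is_jump x (h n)).
  have [k [xk kn]] := hdense x (h n) xn njump'.
  apply: le_lt_trans (gle _ _ (ltW xk)) _.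
  by have [t Gt] := Gh k; have [t' Gt'] := Gh n; apply: Glt Gt Gt' kn.
exists g; split.
- move=> x y; apply/idP/idP; last exact: glt.
  by apply: contraTT; rewrite -!leNgt; apply: gle.
- by exists z; apply: gG.
- by exists u; apply: gG.
- by move=> x; rewrite -(gG _ _ Gz) -(gG _ _ Gu) !gle.
- move=> q q0 q1; have [p [_ h1 pG]] := GT (inl (inr q)).
  have [/mapP[[x t] xp /= ->]|[a [b [jab ap bp aqb]]]] := h1 q0 q1.
    by left; exists x; apply: gG; apply: pG.
  right; exists a.1, b.1; rewrite (gG a.1 a.2) ?(gG b.1 b.2).
  + by move/andP: aqb => [].
  + by rewrite -surjective_pairing; apply: pG.
  + by rewrite -surjective_pairing; apply: pG.
Qed.

(** A point outside the image induces a cut of [L]. If, say, the lower part has a maximum [a], a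
    rational between its image and the point is no value of [g], so it is separated by a jump, and
    maximality of [a] makes the image of that jump surround the point. Hence the image is closed. *)
Lemma complete_order_compact : exists K : set R,
  [/\ compact K, min_accumulation K, isomorphic (@slt d L) (@slt _ R) setT K &
      dense_jumps L -> nowhere_dense K].
Proof.
have [g [gmono [z z0] [u u1] g01 gfill]] := gap_filling_map.
have [zb [zble _ nojump]] := Lbottom.
have gle x y : (g x <= g y) = (x <= y) by rewrite !leNgt gmono.
have zle x : z <= x by rewrite -gle z0; case/andP: (g01 x).
pose K := range g.
have jump_out a b (y : R) : is_jump a b -> g a < y -> y < g b -> ~ closure K y.
  move=> [ab no] ay yb /(_ `]g a, g b[%classic).
  have : nbhs y `]g a, g b[%classic.
    by apply: open_nbhs_nbhs; split; [exact: interval_open | rewrite /= in_itv /= ay].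
  move=> h /(_ h)[_ [[x _ <-] /=]]; rewrite in_itv /= !gmono => axb.
  by apply: no; exists x.
pose I01 : set R := `[0%R, 1%R]%classic.
have cI01 : closed I01 by exact: interval_closed.
have cK01 : K `<=` I01.
  by move=> _ [x _ <-]; rewrite /I01 /= in_itv /=; exact: g01.
have clK : closed K.
  move=> y clKy; apply: contrapT => nKy.
  have := cI01 _ (closureS cK01 clKy).
  rewrite /I01 /= in_itv /= => /andP[y0 y1].
  have {}y0 : 0%R < y.
    by rewrite lt_neqAle y0 andbT; apply/eqP => e; apply: nKy; exists z; rewrite // z0.
  have {}y1 : y < 1%R.
    by rewrite lt_neqAle y1 andbT; apply/eqP => e; apply: nKy; exists u; rewrite // u1.
  pose A := [set x | g x < y]; pose B := [set x | y < g x].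
  have AB x : A x \/ B x.
    rewrite /A /B /=; have [||e] := ltgtP (g x) y; [by left | by right |].
    by case: nKy; exists x.
  suff [a [b [jab ay yb]]] : exists a b, [/\ is_jump a b, g a < y & y < g b].
    exact: jump_out jab ay yb clKy.
  have [_ _ nogap] := Lcomplete.
  have [|[a Aa amax]|[b Bb bmin]] := nogap A B.
  - split; first by exists z; rewrite /A /= z0.
    + by exists u; rewrite /B /= u1.
    + by apply/seteqP; split=> // x _; exact: AB.
    + by move=> a b Aa Bb; rewrite -gmono; apply: lt_trans Bb.
  - have [q [aq qy]] := rat_between Aa.
    have q0 : 0%R < (ratr q : R).
      by apply: le_lt_trans aq; case/andP: (g01 a).
    have [[s sq]|[a' [b' [jab a'q qb']]]] := gfill q q0 (lt_trans qy y1).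
      have As : A s by rewrite /A /= sq.
      by have := amax s As; rewrite -gle sq leNgt aq.
    exists a', b'; split=> //; first exact: lt_trans qy.
    have [Ab'|//] := AB b'; have := amax b' Ab'.
    by rewrite -gle leNgt (lt_trans aq).
  - have [q [yq qb]] := rat_between Bb.
    have q1 : (ratr q : R) < 1%R.
      by apply: lt_le_trans qb _; case/andP: (g01 b).
    have [[s sq]|[a' [b' [jab a'q qb']]]] := gfill q (lt_trans y0 yq) q1.
      have Bs : B s by rewrite /B /= sq.
      by have := bmin s Bs; rewrite -gle sq leNgt qb.
    exists a', b'; split=> //; last exact: lt_trans qb'.
    have [//|Ba'] := AB a'; have := bmin a' Ba'.
    by rewrite -gle leNgt => /negP; case; apply: lt_trans a'q qb.
exists K; split.
- exact: subclosed_compact clK (@segment_compact _ 0%R 1%R) cK01.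
- exists 0%R; split.
  + by exists z.
  + by move=> _ [x _ <-]; case/andP: (g01 x).
  + move=> U /nbhs_ballP[e /= e0 eU].
    suff [x [x0 xe]] : exists x, 0%R < g x /\ g x < e.
      exists (g x); split; [by rewrite gt_eqF | by exists x |].
      by apply: eU; rewrite /ball /= sub0r normrN gtr0_norm.
    have [|q [q0]] := @rat_between R 0%R (Order.min e 1%R).
      by rewrite lt_min e0 ltr01.
    rewrite lt_min => /andP[qe q1].
    have [[s sq]|[a [b [jab aq qb]]]] := gfill q q0 q1.
      by exists s; rewrite sq.
    exists a; split; last exact: lt_trans qe.
    rewrite -z0 gmono lt_neqAle zle andbT; apply/eqP => za; apply: nojump.
    have -> : zb = z by apply/le_anti; rewrite zble zle.
    by exists b; rewrite za.
- exists g; split; last by move=> x y _ _; rewrite /slt gmono.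
  split.
  + by move=> x _; exists x.
  + move=> x y _ _ e; apply/le_anti; by rewrite -!gle e lexx.
  + by move=> _ [x _ <-]; exists x.
- move=> dj; rewrite /nowhere_dense -((closure_id K).1 clK).
  apply/seteqP; split=> // y /= /nbhs_ballP[e /= e0 eK].
  have [x _ xy] : K y by apply: eK; exact: ballxx.
  (* A second point of the ball. If the ball lay in [K], a jump between the two preimages would have
     a rational inside its image that belongs to the ball but not to [K]. *)
  have [x' _ x'y] : K (y + e / 2)%R.
    apply: eK; rewrite /ball /= opprD addNKr normrN gtr0_norm ?divr_gt0 //.
    by rewrite ltr_pdivrMr // mulr_natr mulr2n ltrDl.
  have [|a [b [xa jab bx']]] := dj x x'.
    by rewrite -gmono xy x'y ltrDl divr_gt0.
  have gab : g a < g b by rewrite gmono; case: jab.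
  have [q [aq qb]] := rat_between gab.
  apply: (jump_out a b _ jab aq qb); apply: subset_closure; apply: eK.
  have yq : y < ratr q by apply: le_lt_trans aq; rewrite -xy gle.
  rewrite /ball /= distrC gtr0_norm ?subr_gt0 // ltrBlDl.
  apply: lt_trans qb _; apply: (@le_lt_trans _ _ (g x')); first by rewrite gle.
  by rewrite x'y ltrD2l ltr_pdivrMr // mulr_natr mulr2n ltrDl.
Qed.

End CompactRepresentation.

(** With no inner labels the demand for a comparable pair disappears, which makes the passage from
    compact sets to chains available for antichains. *)
Lemma nowhere_dense_inner_rational (R : realType) (K : set R) :
  nowhere_dense K -> inner_rational K = set0.
Proof.
move=> ndK; apply/seteqP; split=> // s [q [_ [a [c [as_ sc h]]]]].
suff : interior (closure K) s by rewrite ndK.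
apply: (@filterS _ _ _ `]a, c[%classic).
  move=> y; rewrite /= in_itv /= => /andP[ay yc].
  by apply: subset_closure; apply: h.
by apply: open_nbhs_nbhs; split; [exact: interval_open | rewrite /= in_itv /= as_].
Qed.

Theorem theorem1p1 (R : realType) (d : Order.disp_t) (X : porderType d)
    (Xcountable : countable [set: X]) (Xinfinite : infinite_set [set: X]) :
  (ultrahomogeneous X -> ~ antichain X ->
   forall (d' : Order.disp_t) (L : orderType d'),
     [<-> iso_maximal_chain_of_copies X L;
          [/\ embeddable_in R L, complete_order L & bottom_nonisolated L];
          exists K : set R, [/\ compact K, min_accumulation K &
            isomorphic (@slt d' L) (@slt _ R) setT K]]) /\
  (antichain X ->
   forall (d' : Order.disp_t) (L : orderType d'),
     [<-> iso_maximal_chain_of_copies X L;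
          [/\ embeddable_in R L, boolean_order L & bottom_nonisolated L];
          exists K : set R, [/\ compact K, nowhere_dense K,
            min_accumulation K &
            isomorphic (@slt d' L) (@slt _ R) setT K]]).
Proof.
split=> [/ultrahomogeneous_homogeneous hom nanti d' L|anti d' L].
  tfae.
  - move=> [C Cmax [g giso]]; split.
    + exact: maximal_chain_embeddable giso R.
    + exact: maximal_chain_complete giso.
    + exact: maximal_chain_bottom giso R.
  - move=> [emb compl bot].
    by have [K [? ? ? _]] := complete_order_compact emb compl bot; exists K.
  - move=> [K [cK minK iso]].
    apply: (compact_iso_maximal_chain _ _ _ _ cK minK iso) => // _.
    by apply: contrapT => no; apply: nanti => x y xy; apply: no; exists x, y.
have hom := antichain_homogeneous Xinfinite anti.
tfae.
- move=> [C Cmax [g giso]]; split.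
  + exact: maximal_chain_embeddable giso R.
  + split; first exact: maximal_chain_complete giso.
    exact: antichain_dense_jumps giso R _.
  + exact: maximal_chain_bottom giso R.
- move=> [emb [compl dj] bot].
  have [K [? ? ? /(_ dj) ?]] := complete_order_compact emb compl bot.
  by exists K.
- move=> [K [cK ndK minK iso]].
  apply: (compact_iso_maximal_chain _ _ _ _ cK minK iso) => //.
  by rewrite nowhere_dense_inner_rational // => -[].
Qed.
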